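(* The following are equivalent for an integral domain $D$: (1) for every nonzero nonunit $x$ of $D$, $xD$ is a $\ast$-product of finitely many $\ast$-af-homog ideals; (2) $D$ is an almost GCD domain that is a $\ast$-IRKT.
   Context: $\ast$ is a star operation on $D$ of finite character. A $\ast$-ideal is a nonzero fractional ideal $I$ with $I^\ast=I$; of finite type if $I=J^\ast$ for some nonzero finitely generated $J$. A maximal $\ast$-ideal is an integral $\ast$-ideal maximal among proper integral $\ast$-ideals. The $\ast$-product of $I_1,\dots,I_n$ is $(I_1\cdots I_n)^\ast$. A $\ast$-homog ideal is a proper integral $\ast$-ideal $I$ of finite type such that $(A+B)^\ast\neq D$ for every pair $A,B$ of proper integral $\ast$-ideals of finite type containing $I$. A $\ast$-af-homog ideal is a $\ast$-homog ideal $I$ such that for every $\ast$-ideal $J$ of finite type containing $I$ there is $n\ge1$ with $(J^n)^\ast$ principal. $D$ is a $\ast$-IRKT if $D_P$ is a valuation domain for every maximal $\ast$-ideal $P$, $D=\bigcap_P D_P$ over the maximal $\ast$-ideals with the intersection locally finite, and no two distinct maximal $\ast$-ideals contain a common nonzero prime ideal. $D$ is an almost GCD domain if for every pair $a,b$ of nonzero elements there is $n\ge1$ with $a^nD\cap b^nD$ principal. *)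

(* Defs.v *)
(* An integral domain D is represented as a subring of a
   field K which is its field of fractions; (fractional) ideals are subsets
   of K, i.e. predicates K -> Prop, compared with Leibniz equality
   (functional/propositional extensionality are available to proofs). *)
From Stdlib Require Import List.
From HB Require Import structures.
From mathcomp Require Import all_boot all_order all_algebra.
Set Implicit Arguments. Unset Strict Implicit. Unset Printing Implicit Defensive.
Import Order.TTheory GRing.Theory Num.Theory.
Local Open Scope ring_scope.

Section Defs.
Variable K : fieldType.
Implicit Types (D I J A B P Q : K -> Prop) (x y a b : K) (star : (K -> Prop) -> (K -> Prop)).

Definition subset I J := forall y, I y -> J y.

Definition is_subring D :=
  [/\ D 0, D 1, (forall a b, D a -> D b -> D (a + b)),
      (forall a, D a -> D (- a)) & (forall a b, D a -> D b -> D (a * b))].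

Definition is_fraction_field D :=
  forall k, exists a b, [/\ D a, D b, b != 0 & k = a / b].

Definition is_submodule D I :=
  [/\ I 0, (forall a b, I a -> I b -> I (a + b)) &
      (forall d a, D d -> I a -> I (d * a))].

Definition nonzero_set I := exists y, I y /\ y != 0.

Definition fractional D I :=
  [/\ is_submodule D I, nonzero_set I &
      exists d, [/\ D d, d != 0 & forall a, I a -> D (d * a)]].

Definition integral D I := subset I D.

Definition principal D x : K -> Prop := fun y => exists d, D d /\ y = x * d.

Definition scale x I : K -> Prop := fun y => exists a, I a /\ y = x * a.

Definition isum I J : K -> Prop := fun y => exists a b, [/\ I a, J b & y = a + b].
Definition iprod I J : K -> Prop := fun y =>
  exists s : seq (K * K),
    (forall p, p \in s -> I p.1 /\ J p.2) /\ y = \sum_(p <- s) p.1 * p.2.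
Definition iinter I J : K -> Prop := fun y => I y /\ J y.

Definition iprod_list D (l : list (K -> Prop)) : K -> Prop := foldr iprod D l.

Fixpoint ipow D J (n : nat) : K -> Prop :=
  match n with 0%N => D | n'.+1 => iprod J (ipow D J n') end.

Definition gen D (s : seq K) : K -> Prop := fun y =>
  exists c : seq K, [/\ size c = size s, (forall d, d \in c -> D d) &
     y = \sum_(i < size s) c`_i * s`_i].

Definition nonzero_fg D J := exists s : seq K, (exists2 x, x \in s & x != 0) /\ J = gen D s.

Definition star_op D star :=
  (forall I, fractional D I -> fractional D (star I)) /\
  [/\ (forall x, x != 0 -> star (principal D x) = principal D x),
      (forall x I, x != 0 -> fractional D I -> star (scale x I) = scale x (star I)),
      (forall I, fractional D I -> subset I (star I)),
      (forall I J, fractional D I -> fractional D J -> subset I J ->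
                   subset (star I) (star J)) &
      (forall I, fractional D I -> star (star I) = star I)].

Definition finite_character D star :=
  forall I, fractional D I ->
    star I = (fun y => exists J, [/\ nonzero_fg D J, subset J I & star J y]).

Definition star_ideal D star I := fractional D I /\ star I = I.

Definition finite_type D star I :=
  star_ideal D star I /\ exists J, nonzero_fg D J /\ I = star J.

Definition proper_integral_star_ideal D star I :=
  [/\ star_ideal D star I, integral D I & I <> D].

Definition maximal_star_ideal D star P :=
  proper_integral_star_ideal D star P /\
  forall Q, proper_integral_star_ideal D star Q -> subset P Q -> Q = P.

Definition star_product D star (l : list (K -> Prop)) := star (iprod_list D l).

Definition star_homog D star I :=
  [/\ proper_integral_star_ideal D star I, finite_type D star I &
      forall A B, proper_integral_star_ideal D star A -> finite_type D star A ->
                  proper_integral_star_ideal D star B -> finite_type D star B ->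
                  subset I A -> subset I B -> star (isum A B) <> D].

Definition is_principal D I := exists x, I = principal D x.

Definition star_af_homog D star I :=
  star_homog D star I /\
  forall J, finite_type D star J -> subset I J ->
    exists n : nat, (1 <= n)%N /\ is_principal D (star (ipow D J n)).

Definition localization D P : K -> Prop := fun y =>
  exists a s, [/\ D a, D s, ~ P s & y = a / s].

Definition valuation_domain V := forall y, y != 0 -> V y \/ V y^-1.

Definition prime_ideal D Q :=
  [/\ is_submodule D Q, integral D Q, Q <> D &
      forall a b, D a -> D b -> Q (a * b) -> Q a \/ Q b].

Definition star_IRKT D star :=
  [/\ (forall P, maximal_star_ideal D star P -> valuation_domain (localization D P)),
      (forall y, D y <-> (forall P, maximal_star_ideal D star P -> localization D P y)),
      (forall x, D x -> x != 0 -> exists l : list (K -> Prop),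
          forall P, maximal_star_ideal D star P -> P x -> Stdlib.Lists.List.In P l) &
      (forall P1 P2, maximal_star_ideal D star P1 -> maximal_star_ideal D star P2 ->
          P1 <> P2 -> ~ exists Q, [/\ prime_ideal D Q, nonzero_set Q,
                                    subset Q P1 & subset Q P2])].

Definition almost_GCD D :=
  forall a b, D a -> D b -> a != 0 -> b != 0 ->
    exists n : nat, (1 <= n)%N /\
      is_principal D (iinter (principal D (a ^+ n)) (principal D (b ^+ n))).

Definition unit_of D x := D x /\ D x^-1.

End Defs.

(* Main.v *)
(* (1) => (2).  If C is a star-ideal of finite type with (C^n)^* principal, then at every maximal
   star-ideal P one of the generators of C divides all of C in D_P.  Applied to C = (I + xD + yD)^*
   for the af-homog factors I of a factorization, this strips common factors from x and y until one
   divides the other in D_P, so D_P is a valuation domain.  A homog ideal lies in a unique maximal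
   star-ideal, and every prime containing x contains a factor of xD: this gives local finiteness and
   the independence of the maximal star-ideals.  Powers of the factors are principal, so a power of x
   is a product of elements each lying in at most one maximal star-ideal; for such products least
   common multiples exist by comparing factors at a common P.
   (2) => (1).  xD is the star-product of the ideals xD_P \cap D, P running over the maximal
   star-ideals containing x.  Independence yields t in xD_P \cap D outside any other maximal
   star-ideal Q, hence finite type and homogeneity.  Iterating the almost GCD property produces g that
   generates (a_1^n, ..., a_k^n) locally everywhere, so every finite type ideal has a principal
   power.  Throughout, z lies in A^* as soon as it lies in A D_P for every maximal star-ideal P. *)
Require Import Defs.
From Stdlib Require Import List.
From HB Require Import structures.
From mathcomp Require Import all_boot all_order all_algebra.
From mathcomp Require Import boolp ring.
From mathcomp Require classical_sets.
Set Implicit Arguments. Unset Strict Implicit. Unset Printing Implicit Defensive.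
Import Order.TTheory GRing.Theory Num.Theory.
Local Open Scope ring_scope.

(* Importing fintype hides the subset of Defs. *)
Local Notation subset := Defs.subset.

Section Homog.
Context (K : fieldType) (D : K -> Prop).
Context (hD : is_subring D) (hK : is_fraction_field D).
Implicit Types (A B C I J P Q : K -> Prop) (a b d x y z w : K).

(** * Submodules and fractional ideals *)

Lemma subring0 : D 0. Proof. by case: hD. Qed.

Lemma subring1 : D 1. Proof. by case: hD. Qed.

Lemma subringD a b : D a -> D b -> D (a + b). Proof. by case: hD => _ _ h _ _; apply: h. Qed.

Lemma subringM a b : D a -> D b -> D (a * b). Proof. by case: hD => _ _ _ _ h; apply: h. Qed.

Lemma subringX a n : D a -> D (a ^+ n).
Proof.
by move=> Da; elim: n => [|n IH]; rewrite ?expr0 ?exprS; [exact: subring1|exact: subringM].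
Qed.

Lemma submod0 A : is_submodule D A -> A 0. Proof. by case. Qed.

Lemma submodD A a b : is_submodule D A -> A a -> A b -> A (a + b).
Proof. by case=> _ h _; apply: h. Qed.

Lemma submodZ A d a : is_submodule D A -> D d -> A a -> A (d * a).
Proof. by case=> _ _ h; apply: h. Qed.

Lemma submod_sum (T : eqType) (r : seq T) (F : T -> K) A : is_submodule D A ->
  (forall i, i \in r -> A (F i)) -> A (\sum_(i <- r) F i).
Proof.
move=> hA; elim: r => [|i r IH] h; first by rewrite big_nil; exact: submod0.
rewrite big_cons; apply: submodD => //; first by apply: h; rewrite inE eqxx.
by apply: IH => j jr; apply: h; rewrite inE jr orbT.
Qed.

Lemma submodule_ring : is_submodule D D.
Proof. by split; [exact: subring0|exact: subringD|exact: subringM]. Qed.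

Lemma submodule_principal a : is_submodule D (principal D a).
Proof.
split=> [|x y [d [Dd ->]] [e [De ->]]|c x Dc [d [Dd ->]]].
- by exists 0; split; [exact: subring0|rewrite mulr0].
- by exists (d + e); split; [exact: subringD|rewrite mulrDr].
- by exists (c * d); split; [exact: subringM|rewrite mulrCA].
Qed.

Lemma principalE a y : a != 0 -> principal D a y <-> D (y / a).
Proof.
move=> a0; split=> [[d [Dd ->]]|h]; first by rewrite mulrAC divff // mul1r.
by exists (y / a); split => //; rewrite mulrCA divff // mulr1.
Qed.

Lemma principal_mem a : principal D a a.
Proof. by exists 1; split; [exact: subring1|rewrite mulr1]. Qed.

Lemma principal1 : principal D 1 = D.
Proof. by apply/predeqP => y; rewrite (principalE _ (oner_neq0 _)) divr1. Qed.

Lemma common_denominator x y : exists d, [/\ D d, d != 0, D (d * x) & D (d * y)].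
Proof.
have [a [b [Da Db b0 ->]]] := hK x; have [a' [b' [Da' Db' b0' ->]]] := hK y.
exists (b * b'); split; [exact: subringM|by rewrite mulf_neq0| |].
- have -> : b * b' * (a / b) = b' * a by field.
  exact: subringM.
- have -> : b * b' * (a' / b') = b * a' by field.
  exact: subringM.
Qed.

Lemma fractional_principal a : a != 0 -> fractional D (principal D a).
Proof.
move=> a0; split; first exact: submodule_principal.
  by exists a; split => //; exact: principal_mem.
have [d [Dd d0 Dda _]] := common_denominator a a.
exists d; split=> // x [e [De ->]]; rewrite mulrA; exact: subringM.
Qed.

Lemma fractional_ring : fractional D D.
Proof. rewrite -[X in fractional _ X]principal1; exact/fractional_principal/oner_neq0. Qed.

Lemma fractional_integral A : is_submodule D A -> nonzero_set A -> integral D A ->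
  fractional D A.
Proof.
move=> hA nA iA; split=> //; exists 1; split; [exact: subring1|exact: oner_neq0|].
by move=> a Aa; rewrite mul1r; exact: iA.
Qed.

Lemma fractional_scale x A : x != 0 -> fractional D A -> fractional D (scale x A).
Proof.
move=> x0 [hA [a [Aa a0]] [d [Dd d0 hd]]]; split.
- split=> [|_ _ [u [Au ->]] [v [Av ->]]|e _ De [u [Au ->]]].
  + by exists 0; split; [exact: submod0|rewrite mulr0].
  + by exists (u + v); split; [exact: submodD|rewrite mulrDr].
  + by exists (e * u); split; [exact: submodZ|rewrite mulrCA].
- by exists (x * a); split; [exists a|rewrite mulf_neq0].
have [e [De e0 Dex _]] := common_denominator x x.
exists (d * e); split; [exact: subringM|by rewrite mulf_neq0|].
move=> _ [u [Au ->]]; rewrite mulrACA mulrC.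
have -> : e * u * (d * x) = (e * x) * (d * u) by ring.
by apply: subringM => //; exact: hd.
Qed.

Lemma submodule_iprod A B : is_submodule D A -> is_submodule D (iprod A B).
Proof.
move=> hA; split.
- by exists [::]; split => //; rewrite big_nil.
- move=> _ _ [s1 [h1 ->]] [s2 [h2 ->]]; exists (s1 ++ s2); split; last by rewrite big_cat.
  by move=> p; rewrite mem_cat => /orP[/h1|/h2].
- move=> d _ Dd [s [h ->]]; exists [seq (d * p.1, p.2) | p <- s]; split.
    move=> p /mapP[q /h[h1 h2] ->]; split=> //=; exact: submodZ.
  by rewrite big_map mulr_sumr; apply: eq_bigr => p _ /=; rewrite mulrA.
Qed.

Lemma mem_iprod A B a b : A a -> B b -> iprod A B (a * b).
Proof.
move=> Aa Bb; exists [:: (a, b)]; split; last by rewrite big_seq1.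
by move=> p; rewrite inE => /eqP ->.
Qed.

Lemma iprod_sub A B C : is_submodule D C ->
  (forall a b, A a -> B b -> C (a * b)) -> subset (iprod A B) C.
Proof. by move=> hC h _ [s [hs ->]]; apply: submod_sum => // p /hs[? ?]; exact: h. Qed.

Lemma fractional_iprod A B : fractional D A -> fractional D B ->
  fractional D (iprod A B).
Proof.
move=> [hA [a [Aa a0]] [d [Dd d0 hd]]] [hB [b [Bb b0]] [e [De e0 he]]]; split.
- exact: submodule_iprod.
- by exists (a * b); split; [exact: mem_iprod|rewrite mulf_neq0].
exists (d * e); split; [exact: subringM|by rewrite mulf_neq0|].
apply: (@iprod_sub A B (fun y => D (d * e * y))).
  split=> [|x y Dx Dy|c x Dc Dx]; first by rewrite mulr0; exact: subring0.
    by rewrite mulrDr; exact: subringD.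
  by rewrite mulrCA; exact: subringM.
by move=> x y Ax By; rewrite mulrACA; apply: subringM; [exact: hd|exact: he].
Qed.

Lemma submodule_isum A B : is_submodule D A -> is_submodule D B ->
  is_submodule D (isum A B).
Proof.
move=> hA hB; split.
- by exists 0, 0; split; [exact: submod0|exact: submod0|rewrite addr0].
- move=> _ _ [a [b [Aa Bb ->]]] [a' [b' [Aa' Bb' ->]]].
  by exists (a + a'), (b + b'); split; [exact: submodD|exact: submodD|rewrite addrACA].
- move=> d _ Dd [a [b [Aa Bb ->]]].
  by exists (d * a), (d * b); split; [exact: submodZ|exact: submodZ|rewrite mulrDr].
Qed.

Lemma fractional_iprod_list (l : list (K -> Prop)) :
  List.Forall (fractional D) l -> fractional D (iprod_list D l).
Proof.
elim: l => [|I l IH] h /=; first exact: fractional_ring.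
by inversion h; apply: fractional_iprod => //; exact: IH.
Qed.

Lemma fractional_ipow A n : fractional D A -> fractional D (ipow D A n).
Proof.
move=> fA; elim: n => [|n IH] /=; first exact: fractional_ring.
exact: fractional_iprod.
Qed.

Lemma mem_ipow A a n : A a -> ipow D A n (a ^+ n).
Proof.
move=> Aa; elim: n => [|n IH]; first by rewrite expr0; exact: subring1.
by rewrite exprS; exact: mem_iprod.
Qed.

(** * Finitely generated submodules *)

Lemma gen_nil y : gen D [::] y <-> y = 0.
Proof.
split=> [[c [_ _ ->]]|->]; first by rewrite big_ord0.
by exists [::]; split => //; rewrite big_ord0.
Qed.

(** This turns the coefficient-list encoding of [gen] into a recursion on the generators, so that
    later arguments can proceed by induction on the list. *)
Lemma gen_cons a s y :
  gen D (a :: s) y <-> exists d z, [/\ D d, gen D s z & y = d * a + z].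
Proof.
split=> [[[|d c] [//= [sc] hc ->]]|[d [_ [Dd [c [sc hc ->]] ->]]]].
  exists d, (\sum_(i < size s) c`_i * s`_i); split=> //.
  - by apply: hc; rewrite inE eqxx.
  - by exists c; split=> // e ec; apply: hc; rewrite inE ec orbT.
  - by rewrite big_ord_recl.
exists (d :: c); split; rewrite /= ?sc //; last by rewrite big_ord_recl.
by move=> e; rewrite inE => /orP[/eqP ->|/hc].
Qed.

Lemma submodule_gen s : is_submodule D (gen D s).
Proof.
elim: s => [|a s IH].
  split; [exact/gen_nil| |].
    by move=> x y /gen_nil -> /gen_nil ->; rewrite addr0; exact/gen_nil.
  by move=> d x _ /gen_nil ->; rewrite mulr0; exact/gen_nil.
split.
- by apply/gen_cons; exists 0, 0; split; [exact: subring0|exact: submod0|rewrite mul0r addr0].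
- move=> _ _ /gen_cons[d [x [Dd sx ->]]] /gen_cons[e [y [De sy ->]]].
  apply/gen_cons; exists (d + e), (x + y).
  by split; [exact: subringD|exact: submodD|rewrite mulrDl addrACA].
- move=> c _ Dc /gen_cons[d [x [Dd sx ->]]]; apply/gen_cons.
  by exists (c * d), (c * x); split; [exact: subringM|exact: submodZ|rewrite mulrDr mulrA].
Qed.

Lemma mem_gen s a : a \in s -> gen D s a.
Proof.
elim: s => [//|b s IH]; rewrite inE => /orP[/eqP ->|/IH h]; apply/gen_cons.
  exists 1, 0; split; [exact: subring1|exact: (submod0 (submodule_gen s))|].
  by rewrite mul1r addr0.
by exists 0, a; split; [exact: subring0| |rewrite mul0r add0r].
Qed.

Lemma gen_sub s A : is_submodule D A -> (forall a, a \in s -> A a) -> subset (gen D s) A.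
Proof.
move=> hA; elim: s => [|a s IH] h y; first by move=> /gen_nil ->; exact: submod0.
move=> /gen_cons[d [z [Dd sz ->]]]; apply: submodD => //.
  by apply: submodZ => //; apply: h; rewrite inE eqxx.
by apply: IH sz => b bs; apply: h; rewrite inE bs orbT.
Qed.

Lemma gen_incl s1 s2 : {subset s1 <= s2} -> subset (gen D s1) (gen D s2).
Proof. by move=> h; apply: gen_sub (submodule_gen _) _ => a /h; exact: mem_gen. Qed.

Lemma fractional_gen s : (exists2 x, x \in s & x != 0) -> fractional D (gen D s).
Proof.
move=> [x xs x0]; split; first exact: submodule_gen.
  by exists x; split => //; exact: mem_gen.
suff [d [Dd d0 h]] : exists d, [/\ D d, d != 0 & forall a, a \in s -> D (d * a)].
  exists d; split=> //; apply: gen_sub => //.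
  split=> [|y z Dy Dz|c y Dc Dy]; first by rewrite mulr0; exact: subring0.
    by rewrite mulrDr; exact: subringD.
  by rewrite mulrCA; exact: subringM.
elim: {x xs x0} s => [|a s [d [Dd d0 h]]].
  by exists 1; split; [exact: subring1|exact: oner_neq0|].
have [e [De e0 Dea _]] := common_denominator a a.
exists (d * e); split; [exact: subringM|by rewrite mulf_neq0|].
move=> b; rewrite inE => /orP[/eqP ->|/h Db]; first by rewrite -mulrA; exact: subringM.
by rewrite mulrAC mulrC; exact: subringM.
Qed.

Lemma proper_has_not1 A : is_submodule D A -> integral D A -> A <> D -> ~ A 1.
Proof.
move=> hA iA nA A1; apply: nA; apply/predeqP => y; split; first exact: iA.
by move=> Dy; rewrite -[y]mulr1; exact: submodZ.
Qed.

Lemma integral_iprod_list (l : list (K -> Prop)) :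
  List.Forall (integral D) l -> integral D (iprod_list D l).
Proof.
elim: l => [|I l IH] /=; first by move=> _ y.
move=> /List.Forall_cons_iff[iI il].
apply: (@iprod_sub I (iprod_list D l) D); first exact: submodule_ring.
by move=> a b /iI Da /(IH il); exact: subringM.
Qed.

(** * Localization at a prime ideal *)

Section Localization.
Context (P : K -> Prop) (hP : prime_ideal D P).
Notation loc := (localization D P).

Lemma prime_submodule : is_submodule D P. Proof. by case: hP. Qed.

Lemma prime_not1 : ~ P 1.
Proof. by case: hP => hs hi hn _; exact: proper_has_not1 hn. Qed.

Lemma prime_notM a b : D a -> D b -> ~ P a -> ~ P b -> ~ P (a * b).
Proof. by case: hP => _ _ _ h Da Db na nb /(h _ _ Da Db) []. Qed.

Lemma prime_not_neq0 a : ~ P a -> a != 0.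
Proof. by move=> na; apply/eqP => a0; apply: na; rewrite a0; exact: submod0 prime_submodule. Qed.

Lemma prime_notX a n : D a -> ~ P a -> ~ P (a ^+ n).
Proof.
move=> Da na; elim: n => [|n IH]; first by rewrite expr0; exact: prime_not1.
by rewrite exprS; apply: prime_notM => //; exact: subringX.
Qed.

Lemma loc_ring y : D y -> loc y.
Proof.
by move=> Dy; exists y, 1; split; [|exact: subring1|exact: prime_not1|rewrite divr1].
Qed.

Lemma loc_inv s : D s -> ~ P s -> loc s^-1.
Proof. by move=> Ds ns; exists 1, s; split; [exact: subring1| | |rewrite mul1r]. Qed.

Lemma locM x y : loc x -> loc y -> loc (x * y).
Proof.
move=> [a [s [Da Ds ns ->]]] [b [t [Db Dt nt ->]]]; exists (a * b), (s * t); split.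
- exact: subringM.
- exact: subringM.
- exact: prime_notM.
- by rewrite mulf_div.
Qed.

Lemma locD x y : loc x -> loc y -> loc (x + y).
Proof.
move=> [a [s [Da Ds ns ->]]] [b [t [Db Dt nt ->]]].
exists (a * t + b * s), (s * t); split.
- by apply: subringD; exact: subringM.
- exact: subringM.
- exact: prime_notM.
- by rewrite addf_div //; exact: prime_not_neq0.
Qed.

Lemma locX x n : loc x -> loc (x ^+ n).
Proof.
move=> lx; elim: n => [|n IH]; first by rewrite expr0; exact/loc_ring/subring1.
by rewrite exprS; exact: locM.
Qed.

Lemma loc_trans a b c : b != 0 -> loc (b / a) -> loc (c / b) -> loc (c / a).
Proof.
move=> b0 ba cb.
have -> : c / a = (c / b) * (b / a) by rewrite mulrA mulfVK.
exact: locM.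
Qed.

Lemma loc_clear y : loc y -> exists s, [/\ D s, ~ P s & D (s * y)].
Proof.
move=> [a [s [Da Ds ns ->]]]; exists s; split=> //.
by rewrite mulrCA divff ?mulr1 //; exact: prime_not_neq0.
Qed.

Lemma loc_of_clear s y : D s -> ~ P s -> D (s * y) -> loc y.
Proof.
move=> Ds ns Dsy; exists (s * y), s; split=> //.
by rewrite mulrAC divff ?mul1r //; exact: prime_not_neq0.
Qed.

(** For nonzero [w] this set is $wD_P$. Being a submodule, it can serve as the target when an
    inclusion is checked on generators or on products of elements. *)
Lemma submodule_loc w : is_submodule D (fun z => loc (z / w)).
Proof.
split=> [|x y lx ly|d x Dd lx]; first by rewrite mul0r; exact/loc_ring/subring0.
  by rewrite mulrDl; exact: locD.
by rewrite -mulrA; apply: locM => //; exact: loc_ring.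
Qed.

(** Writing $y^{-1} = a/s$ gives $s = ay$, so [y] in [P] would force the denominator [s] into
    [P]. *)
Lemma loc_unit_notin y : D y -> y != 0 -> loc y^-1 -> ~ P y.
Proof.
move=> Dy y0 [a [s [Da Ds ns e]]] Py; apply: ns.
have -> : s = a * y; last exact: submodZ prime_submodule Da Py.
have s0 : s != 0.
  apply/eqP => s0; move: e; rewrite s0 invr0 mulr0 => /eqP.
  by rewrite invr_eq0 (negbTE y0).
by rewrite -[y]invrK e invf_div mulrCA divff ?mulr1 //; apply: contra_neq y0 => a0;
  apply/eqP; rewrite -invr_eq0 e a0 mul0r.
Qed.

(** Induction on the list. If the first factor has an element [x] outside [P], then $xy \in P$
    forces every [y] of the remaining product into [P]. The empty product is [D], which contains
    1. *)
Lemma prime_iprod_list (l : list (K -> Prop)) : subset (iprod_list D l) P ->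
  List.Forall (integral D) l -> exists I, List.In I l /\ subset I P.
Proof.
elim: l => [|I l IH] /= h hl; first by case: prime_not1; apply: h; exact: subring1.
have /List.Forall_cons_iff[iI il] := hl.
have [sI|] := EM (subset I P); first by exists I; split; [left|].
move=> /existsNP[x /not_implyP[Ix nPx]].
have [J [Jl JP]] : exists J, List.In J l /\ subset J P.
  apply: IH => // y ly; apply: contrapT => nPy.
  apply: (prime_notM (iI _ Ix) _ nPx nPy); last by apply: h; exact: mem_iprod.
  exact: integral_iprod_list ly.
by exists J; split; [right|].
Qed.
End Localization.

(** * Star operations of finite character *)

Section StarOperation.
Context (star : (K -> Prop) -> (K -> Prop)).
Context (hstar : star_op D star) (hfc : finite_character D star).
Notation maxs := (maximal_star_ideal D star).

Lemma star_fractional A : fractional D A -> fractional D (star A).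
Proof. by case: hstar => h _; exact: h. Qed.

Lemma star_principal x : x != 0 -> star (principal D x) = principal D x.
Proof. by case: hstar => _ [h _ _ _ _]; exact: h. Qed.

Lemma star_ring : star D = D.
Proof. by have := star_principal (oner_neq0 K); rewrite principal1. Qed.

Lemma star_ext A : fractional D A -> subset A (star A).
Proof. by case: hstar => _ [_ _ h _ _]; exact: h. Qed.

Lemma star_mono A B : fractional D A -> fractional D B -> subset A B ->
  subset (star A) (star B).
Proof. by case: hstar => _ [_ _ _ h _]; exact: h. Qed.

Lemma star_idem A : fractional D A -> star (star A) = star A.
Proof. by case: hstar => _ [_ _ _ _ h]; exact: h. Qed.

Lemma star_submodule A : fractional D A -> is_submodule D (star A).
Proof. by case/star_fractional. Qed.

Lemma star_sub A B : fractional D A -> star_ideal D star B -> subset A B ->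
  subset (star A) B.
Proof. by move=> fA [fB {2}<-]; exact: star_mono. Qed.

Lemma star_ideal_star A : fractional D A -> star_ideal D star (star A).
Proof. by move=> fA; split; [exact: star_fractional|exact: star_idem]. Qed.

Lemma star_ideal_principal x : x != 0 -> star_ideal D star (principal D x).
Proof. by move=> x0; split; [exact: fractional_principal|exact: star_principal]. Qed.

Lemma star_ideal_ring : star_ideal D star D.
Proof. by split; [exact: fractional_ring|exact: star_ring]. Qed.

(** Since [star] commutes with scaling, $wA \subseteq B$ gives $wA^* \subseteq B$. Conditions that
    are multiplicative in [w] thereby pass from an ideal, or from its generators, to the
    star-closure. *)
Lemma star_colon A B w : fractional D A -> star_ideal D star B -> w != 0 ->
  (forall a, A a -> B (w * a)) -> forall y, star A y -> B (w * y).
Proof.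
move=> fA sB w0 h y sy.
apply: (star_sub (fractional_scale w0 fA) sB); first by move=> _ [a [Aa ->]]; exact: h.
by case: hstar => _ [_ -> //]; exists y.
Qed.

Lemma star_gen A y : fractional D A -> star A y ->
  exists s, [/\ forall a, a \in s -> A a, exists2 x, x \in s & x != 0 & star (gen D s) y].
Proof.
move=> fA; rewrite (hfc fA) => -[_ [[s [nz ->]] sA sy]]; exists s; split=> // a sa.
by apply: sA; exact: mem_gen.
Qed.

Lemma proper_star_ideal A : is_submodule D A -> nonzero_set A -> integral D A ->
  ~ A 1 -> subset (star A) A -> proper_integral_star_ideal D star A.
Proof.
move=> hA nA iA A1 sA; have fA := fractional_integral hA nA iA.
split=> //; last by move=> AD; apply: A1; rewrite AD; exact: subring1.
by split=> //; apply/predeqP => y; split; [exact: sA|exact: star_ext].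
Qed.

Lemma proper_star_ideal_not1 A : proper_integral_star_ideal D star A -> ~ A 1.
Proof. by move=> [[[hA _ _] _] iA nA]; exact: proper_has_not1 nA. Qed.

(** * Existence of maximal star-ideals *)

Lemma chain_finite (F : (K -> Prop) -> Prop) (s : seq K) (X0 : K -> Prop) : F X0 ->
  (forall X Y, F X -> F Y -> subset X Y \/ subset Y X) ->
  (forall a, a \in s -> exists X, F X /\ X a) ->
  exists X, F X /\ forall a, a \in s -> X a.
Proof.
move=> F0 chain; elim: s => [|a s IH] h; first by exists X0.
have [X [FX Xs]] : exists X, F X /\ forall a, a \in s -> X a.
  by apply: IH => b bs; apply: h; rewrite inE bs orbT.
have [Y [FY Ya]] : exists Y, F Y /\ Y a by apply: h; rewrite inE eqxx.
have [XY|YX] := chain _ _ FX FY.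
- by exists Y; split=> // b; rewrite inE => /orP[/eqP ->|/Xs/XY].
- by exists X; split=> // b; rewrite inE => /orP[/eqP ->|/Xs]; first exact: YX.
Qed.

(** Zorn's lemma. The union of a chain is star-closed by finite character: an element of its closure
    lies in the closure of finitely many elements, and these already lie in a single member of the
    chain. *)
Lemma exists_maximal_star_ideal I : proper_integral_star_ideal D star I ->
  exists P, maxs P /\ subset I P.
Proof.
move=> pI.
pose R (A : K -> Prop) := (forall y, ~ A y) \/
  (proper_integral_star_ideal D star A /\ subset I A).
have I0 : I 0 by case: pI => -[[/submod0]].
have [F FR chain|M [RM maxM]] := @classical_sets.Zorn_bigcup K R.
  have [[X0 [F0 [y0 X0y0]]]|hno] := EM (exists X, F X /\ exists y, X y); last first.
    by left=> y [X FX Xy]; apply: hno; exists X; split => //; exists y.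
  right; pose G X := F X /\ exists y, X y.
  have GR X : G X -> proper_integral_star_ideal D star X /\ subset I X.
    by move=> [/FR[nX|//] [y Xy]]; case: (nX y).
  have [pX0 IX0] := GR X0 (conj F0 (ex_intro _ _ X0y0)).
  have chG X Y : G X -> G Y -> subset X Y \/ subset Y X by move=> [? _] [? _]; exact: chain.
  have GU y : classical_sets.bigcup F id y -> exists X, G X /\ X y.
    by move=> [X FX Xy]; exists X; split => //; split => //; exists y.
  have UG X y : G X -> X y -> classical_sets.bigcup F id y by move=> [FX _] Xy; exists X.
  have G0 : G X0 by split => //; exists y0.
  have sm X : G X -> is_submodule D X by move=> /GR[[[[]]]].
  have fin (s : seq K) : (forall a, a \in s -> classical_sets.bigcup F id a) ->
      exists X, G X /\ forall a, a \in s -> X a.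
    by move=> h; apply: (chain_finite G0 chG) => a /h/GU.
  split; last by move=> y /IX0 Xy; exact: UG Xy.
  have smU : is_submodule D (classical_sets.bigcup F id).
    split=> [|a b Ua Ub|d a Dd Ua].
    - by apply: (UG X0) => //; exact: IX0.
    - have [|X [GX h]] := fin [:: a; b]; first by move=> c; rewrite !inE => /orP[]/eqP ->.
      by apply: (UG X) => //; apply: submodD; [exact: sm|apply: h|apply: h];
        rewrite !inE eqxx ?orbT.
    - have [X [GX Xa]] := GU _ Ua; apply: (UG X) => //; apply: submodZ => //; exact: sm.
  apply: proper_star_ideal => //.
  - by case: pX0 => -[[_ [x [Xx x0]] _] _] _ _; exists x; split=> //; exact: UG Xx.
  - by move=> y /GU[X [/GR[[_ iX _] _] /iX]].
  - by move=> /GU[X [/GR[/proper_star_ideal_not1]]].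
  move=> y; have fU : fractional D (classical_sets.bigcup F id).
    apply: fractional_integral => //.
      by case: pX0 => -[[_ [x [Xx x0]] _] _] _ _; exists x; split=> //; exact: UG Xx.
    by move=> z /GU[X [/GR[[_ iX _] _] /iX]].
  move=> /(star_gen fU)[s [/fin[X [GX Xs]] nzs sy]]; apply: (UG X) => //.
  have [[sX _ _] _] := GR _ GX; apply: (star_sub (fractional_gen nzs) sX) sy.
  by apply: gen_sub => //; exact: sm.
have IM : proper_integral_star_ideal D star M /\ subset I M.
  case: RM => // nM; case: (maxM I); last by right; split=> // y.
  by split=> [y /nM|/(_ _ I0)/nM].
case: IM => pM IM; exists M; split=> //; split=> // Q pQ MQ.
apply: contrapT => QM; case: (maxM Q); last by right; split => // y /IM/MQ.
by split=> // QM'; apply: QM; apply/predeqP => y; split; [exact: QM'|exact: MQ].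
Qed.

(** * Maximal star-ideals are prime; star-closure and localization *)

Section Maximal.
Context (P : K -> Prop) (hP : maxs P).

Lemma max_submodule : is_submodule D P. Proof. by case: hP => -[[[]]]. Qed.

Lemma max_integral : integral D P. Proof. by case: hP => -[]. Qed.

Lemma max_star_ideal : star_ideal D star P. Proof. by case: hP => -[]. Qed.

Lemma max_not1 : ~ P 1. Proof. by case: hP => /proper_star_ideal_not1. Qed.

Lemma max_nonzero : nonzero_set P. Proof. by case: hP => -[[[]]]. Qed.

(** Otherwise the star-closure of [A] would be a proper integral star-ideal above [P], hence equal
    to [P] by maximality, although it contains [a]. *)
Lemma max_star_full A a : is_submodule D A -> integral D A -> subset P A -> A a -> ~ P a ->
  star A 1.
Proof.
move=> hA iA PA Aa nPa; apply: contrapT => nA1.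
have nzA : nonzero_set A by have [x [Px x0]] := max_nonzero; exists x; split => //; exact: PA.
have fA := fractional_integral hA nzA iA.
have pA : proper_integral_star_ideal D star (star A).
  apply: proper_star_ideal => //.
  - exact: star_submodule.
  - by case: (star_fractional fA).
  - exact: star_sub star_ideal_ring iA.
  - by rewrite star_idem.
apply: nPa; case: hP => _ /(_ _ pA) <-; first exact: star_ext.
by move=> x /PA; exact: star_ext.
Qed.

(** If $ab \in P$ and $a \notin P$, then 1 lies in $(P + aD)^*$. Since $b(P + aD) \subseteq P$ and
    [P] is star-closed, $b = b \cdot 1$ lies in [P]. *)
Lemma max_prime : prime_ideal D P.
Proof.
split; [exact: max_submodule|exact: max_integral|by case: hP => -[]|].
move=> a b Da Db Pab; apply: contrapT => /not_orP[nPa nPb].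
have sP := max_submodule.
have h1 : star (isum P (principal D a)) 1.
  apply: (@max_star_full _ a) => //.
  - by apply: submodule_isum => //; exact: submodule_principal.
  - move=> _ [p [_ [Pp [d [Dd ->]] ->]]]; apply: subringD; first exact: max_integral.
    exact: subringM.
  - by move=> p Pp; exists p, 0; split; rewrite ?addr0 //; exact: submod0 (submodule_principal _).
  - by exists 0, a; split; rewrite ?add0r //; [exact: submod0|exact: principal_mem].
have b0 : b != 0 by apply/eqP => b0; apply: nPb; rewrite b0; exact: submod0.
apply: nPb; rewrite -[b]mulr1; apply: star_colon h1 => //; last first.
- move=> _ [p [_ [Pp [d [Dd ->]] ->]]]; rewrite mulrDr; apply: submodD => //.
    exact: submodZ.
  have -> : b * (a * d) = d * (a * b) by ring.
  exact: submodZ.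
- exact: max_star_ideal.
apply: fractional_integral.
- by apply: submodule_isum => //; exact: submodule_principal.
- have [x [Px x0]] := max_nonzero; exists x; split=> //.
  by exists x, 0; split; rewrite ?addr0 //; exact: submod0 (submodule_principal _).
- move=> _ [p [_ [Pp [d [Dd ->]] ->]]]; apply: subringD; first exact: max_integral.
  exact: subringM.
Qed.

(** By finite character only finitely many elements of [A] matter for a given [y]. A common
    denominator [t] outside [P] moves them into [D] after multiplication by $t/w$, and [star_colon]
    then does the same for [y]. *)
Lemma star_loc A w : fractional D A -> w != 0 ->
  (forall a, A a -> localization D P (a / w)) ->
  forall y, star A y -> localization D P (y / w).
Proof.
move=> fA w0 h y /(star_gen fA)[s [sA nzs sy]].
have [t [Dt nt ht]] : exists t, [/\ D t, ~ P t & forall a, a \in s -> D (t * (a / w))].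
  elim: s sA {nzs sy} => [|a s IH] sA.
    by exists 1; split; [exact: subring1|exact: max_not1|].
  have [t [Dt nt ht]] : exists t, [/\ D t, ~ P t & forall a, a \in s -> D (t * (a / w))].
    by apply: IH => b bs; apply: sA; rewrite inE bs orbT.
  have [|u [Du nu hu]] := loc_clear max_prime (h a _); first by apply: sA; rewrite inE eqxx.
  exists (t * u); split; [exact: subringM|exact: (prime_notM max_prime)|].
  move=> b; rewrite inE => /orP[/eqP ->|/ht hb]; first by rewrite -mulrA; exact: subringM.
  by rewrite mulrAC mulrC; exact: subringM.
apply: (loc_of_clear max_prime Dt nt).
have t0 := prime_not_neq0 max_prime nt.
rewrite mulrCA mulrC; apply: star_colon sy.
- exact: fractional_gen.
- exact: star_ideal_ring.
- by rewrite mulf_neq0 // invr_eq0.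
apply: (@gen_sub _ (fun a => D (t / w * a))) => [|a /ht]; last by rewrite mulrCA mulrC.
split=> [|x z Dx Dz|c x Dc Dx]; first by rewrite mulr0; exact: subring0.
  by rewrite mulrDr; exact: subringD.
by rewrite mulrCA; exact: subringM.
Qed.

Lemma ipow_loc A a n : (forall x, A x -> localization D P (x / a)) ->
  forall x, ipow D A n x -> localization D P (x / a ^+ n).
Proof.
move=> h; elim: n => [|n IH] x /=.
  by move=> Dx; rewrite expr0 divr1; exact: loc_ring max_prime _ _.
apply: (@iprod_sub A (ipow D A n) (fun z => localization D P (z / a ^+ n.+1))).
  exact: (submodule_loc max_prime).
move=> {}x y Ax Ay.
by rewrite exprS -mulf_div; apply: (locM max_prime); [exact: h|exact: IH].
Qed.

End Maximal.

(** The elements [d] of [D] with $zd \in A^*$ form an ideal [T] that is star-closed. The hypothesis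
    says that no maximal star-ideal contains [T], so [T] contains 1. *)
Lemma star_local A z : fractional D A ->
  (forall P, maxs P -> exists s, [/\ D s, ~ P s & star A (s * z)]) -> star A z.
Proof.
move=> fA h; have fsA := star_fractional fA; have hs := star_submodule fA.
have [->|z0] := eqVneq z 0; first exact: submod0.
pose T d := D d /\ star A (z * d).
have sT : is_submodule D T.
  split=> [|c d [Dc hc] [Dd hd]|c d Dc [Dd hd]].
  - by split; [exact: subring0|rewrite mulr0; exact: submod0].
  - by split; [exact: subringD|rewrite mulrDr; exact: submodD].
  - by split; [exact: subringM|rewrite mulrCA; exact: submodZ].
have nT : nonzero_set T.
  have [a [Aa a0]] : nonzero_set (star A) by case: fsA.
  have [d [Dd d0 Ddz Dda]] := common_denominator z a.
  (* As [d] clears the denominators of both [z] and [a], the element $da$ is in [D] and $z \cdot da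
     = (dz)a$ is a [D]-multiple of [a]. *)
  exists (d * a); split; last exact: mulf_neq0.
  split=> //; rewrite mulrA [z * d]mulrC; exact: submodZ.
have iT : integral D T by move=> d [].
suff [_] : T 1 by rewrite mulr1.
apply: contrapT => nT1.
have pT : proper_integral_star_ideal D star T.
  apply: proper_star_ideal => // y sy; have fT := fractional_integral sT nT iT.
  split; first by apply: star_sub sy => //; exact: star_ideal_ring.
  apply: star_colon sy => //; first exact: star_ideal_star.
  by move=> a [].
have [P [mP TP]] := exists_maximal_star_ideal pT.
have [s [Ds ns hsz]] := h _ mP; apply: ns; apply: TP; split => //.
by rewrite mulrC.
Qed.

Lemma ring_local y : (forall P, maxs P -> localization D P y) -> D y.
Proof.
move=> h; rewrite -star_ring; apply: star_local; first exact: fractional_ring.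
move=> P mP; have [s [Ds ns Dsy]] := loc_clear (max_prime mP) (h _ mP).
by exists s; split=> //; rewrite star_ring.
Qed.

Lemma af_fractional I : star_af_homog D star I -> fractional D I.
Proof. by case=> -[[[]]]. Qed.

Lemma af_integral I : star_af_homog D star I -> integral D I.
Proof. by case=> -[[]]. Qed.

(** * Consequences of factorization into af-homog ideals *)

(* f is chosen so that f w / c is a unit of D_P for some w in C^(n-1), where (C^n)^* = cD; since
   C w / c lies in D, every element of C is then a multiple of f in D_P. *)
Lemma local_generator (s : seq K) n P : (exists2 x, x \in s & x != 0) -> (1 <= n)%N ->
  is_principal D (star (ipow D (star (gen D s)) n)) -> maxs P ->
  exists f, [/\ f \in s, f != 0 & forall z, star (gen D s) z -> localization D P (z / f)].
Proof.
case: n => [//|n] nz _ [c hc] mP; have pP := max_prime mP.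
have fg := fractional_gen nz.
have fC := star_fractional fg; have fW := fractional_ipow n fC.
have fCW := fractional_iprod fC fW.
have c0 : c != 0.
  have [_ [y [sy y0]] _] := star_fractional fCW; move: sy; rewrite [star _]hc => -[d [_ e]].
  by apply: contra_neq y0 => c0; rewrite e c0 mul0r.
have hD1 z w : star (gen D s) z -> ipow D (star (gen D s)) n w -> D (z * w / c).
  move=> Cz Ww; apply/(principalE _ c0); rewrite -hc; apply: star_ext => //.
  exact: mem_iprod.
(* If every $fw/c$ lay in [P], then so would $zw/c$ for all [z] in the closure of the generators,
   and next $c^{-1}y$ for all [y] in the closure of the [n.+1]-st power. That closure contains [c],
   so 1 would lie in [P]. *)
have [f [w [fs Ww nP]]] : exists f w, [/\ f \in s, ipow D (star (gen D s)) n w & ~ P (f * w / c)].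
  apply: contrapT => hno; apply: (max_not1 mP); rewrite -(mulVf c0).
  apply: (star_colon fCW (max_star_ideal mP)); first by rewrite invr_eq0.
    apply: (@iprod_sub _ _ (fun z => P (c^-1 * z))).
      have hP := max_submodule mP; split=> [|x y Px Py|d x Dd Px].
      - by rewrite mulr0; exact: submod0.
      - by rewrite mulrDr; exact: submodD.
      - by rewrite mulrCA; exact: submodZ.
    move=> z w Cz Ww; rewrite mulrA mulrAC.
    have [->|w0] := eqVneq w 0; first by rewrite mulr0 mul0r; exact: submod0 (max_submodule mP).
    rewrite [c^-1 * w]mulrC.
    apply: star_colon Cz => //; first exact: max_star_ideal.
      by rewrite mulf_neq0 // invr_eq0.
    apply: (@gen_sub _ (fun z => P (w / c * z))).
      have hP := max_submodule mP; split=> [|x y Px Py|d x Dd Px].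
      - by rewrite mulr0; exact: submod0.
      - by rewrite mulrDr; exact: submodD.
      - by rewrite mulrCA; exact: submodZ.
    move=> a sa; apply: contrapT => na; apply: hno; exists a, w; split=> //.
    by have -> : a * w / c = w / c * a by ring.
  by have := principal_mem c; rewrite -hc.
have u0 := prime_not_neq0 pP nP.
have f0 : f != 0 by apply: contra_neq u0 => ->; rewrite !mul0r.
have w0 : w != 0 by apply: contra_neq u0 => ->; rewrite mulr0 mul0r.
exists f; split=> // z Cz.
have -> : z / f = (z * w / c) * (f * w / c)^-1 by field; rewrite c0 w0 f0.
apply: (locM pP); first exact: loc_ring pP _ (hD1 _ _ Cz Ww).
apply: (loc_inv _ nP); apply: hD1 => //; apply: star_ext => //; exact: mem_gen.
Qed.

(** Apply [local_generator] to [x], [y] and the generators of [I]. If [f] is [x] or [y], one of the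
    two divides the other in $D_P$; if [f] is in [I], it is a common divisor that can be cancelled
    at the expense of the factor [I]. *)
Lemma af_comparison I x y P : star_af_homog D star I -> maxs P -> x != 0 -> y != 0 ->
  exists f, [/\ f != 0, [\/ f = x, f = y | I f], localization D P (x / f)
    & localization D P (y / f)].
Proof.
move=> [[_ [_ [_ [[s [nz ->]] eI]]] _] af] mP x0 y0.
have nz' : exists2 z, z \in x :: y :: s & z != 0 by exists x; rewrite ?inE ?eqxx.
have fg := fractional_gen nz'.
have [|z|n [n1 pn]] := af (star (gen D (x :: y :: s))).
- by split; [exact: star_ideal_star|exists (gen D (x :: y :: s)); split => //; exists (x :: y :: s)].
- rewrite eI; apply: star_mono => //; first exact: fractional_gen.
  by apply: gen_incl => a; rewrite !inE => ->; rewrite !orbT.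
have [f [fs f0 hf]] := local_generator nz' n1 pn mP.
exists f; split=> //.
- move: fs; rewrite !inE => /or3P[/eqP ->|/eqP ->|fs]; [exact: Or31|exact: Or32|apply: Or33].
  by rewrite eI; apply: star_ext; [exact: fractional_gen|exact: mem_gen].
- by apply: hf; apply: star_ext => //; apply: mem_gen; rewrite inE eqxx.
- by apply: hf; apply: star_ext => //; apply: mem_gen; rewrite !inE eqxx orbT.
Qed.

(** The invariant is that the product of the remaining factors lies in $xD_P$. Replacing [x], [y] by
    [x / f], [y / f] with [f] in the first factor preserves it for the rest of the list. Once the
    list is empty the product is [D], so $1/x \in D_P$ and [x] divides [y]. *)
Lemma comparable_of_af_list (l : list (K -> Prop)) P x y : List.Forall (star_af_homog D star) l ->
  maxs P -> x != 0 -> y != 0 -> localization D P y ->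
  (forall z, iprod_list D l z -> localization D P (z / x)) ->
  localization D P (y / x) \/ localization D P (x / y).
Proof.
move=> hl mP; have pP := max_prime mP.
elim: l hl x y => [|I l IH] hl x y x0 y0 ly h.
  left; apply: (locM pP) => //; rewrite -[x^-1]mul1r; apply: h; exact: subring1.
have /List.Forall_cons_iff[afI afl] := hl.
have [f [f0 [e|e|If] lx ly']] := af_comparison afI mP x0 y0; try by [left; rewrite -e|right; rewrite -e].
have ee u v : u / v = (u / f) / (v / f) by rewrite -mulf_div divff ?invr_eq0 // ?mulr1.
rewrite (ee y x) (ee x y); apply: IH => //; try by rewrite mulf_neq0 // invr_eq0.
move=> z lz; have -> : z / (x / f) = f * z / x by field; rewrite x0 f0.
by apply: h; exact: mem_iprod.
Qed.

(** * A homog ideal lies in at most one maximal star-ideal *)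

Lemma proper_finite_type_gen P (s : seq K) : maxs P -> (exists2 x, x \in s & x != 0) ->
  (forall a, a \in s -> P a) ->
  proper_integral_star_ideal D star (star (gen D s)) /\ finite_type D star (star (gen D s)).
Proof.
move=> mP nz sP; have fg := fractional_gen nz.
have sub : subset (star (gen D s)) P.
  by apply: star_sub (max_star_ideal mP) _ => //; exact: gen_sub (max_submodule mP) sP.
split; last by split; [exact: star_ideal_star|exists (gen D s); split => //; exists s].
apply: proper_star_ideal.
- exact: star_submodule.
- by case: (star_fractional fg).
- by move=> y /sub; exact: max_integral.
- by move=> /sub; exact: max_not1.
- by rewrite star_idem.
Qed.

(** For [p] in [P] outside [Q] the closure of $Q + pD$ contains 1, and finite character reduces this
    to finitely many elements $q + pd$. Adjoining [p] to [I], respectively the elements [q] to [I],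
    gives proper finite type star-ideals inside [P] and [Q] whose sum has closure [D], against
    homogeneity. *)
Lemma homog_max_unique I P Q : star_homog D star I -> maxs P -> maxs Q ->
  subset I P -> subset I Q -> P = Q.
Proof.
move=> [_ [_ [_ [[s [nz ->]] eI]]] hI] mP mQ IP IQ; apply: contrapT => PQ.
have Is a : a \in s -> I a.
  by move=> sa; rewrite eI; apply: star_ext; [exact: fractional_gen|exact: mem_gen].
have [p [Pp nQp]] : exists p, P p /\ ~ Q p.
  apply: contrapT => hno; apply: PQ; case: mP => _ /(_ Q) -> //; first by case: mQ.
  by move=> x Px; apply: contrapT => nQ; apply: hno; exists x.
have sQ := max_submodule mQ.
have sm : is_submodule D (isum Q (principal D p)).
  by apply: submodule_isum => //; exact: submodule_principal.
have im : integral D (isum Q (principal D p)).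
  move=> _ [q [_ [Qq [d [Dd ->]] ->]]]; apply: subringD; first exact: (max_integral mQ).
  by apply: subringM => //; exact: (max_integral mP).
have Qm : subset Q (isum Q (principal D p)).
  by move=> q Qq; exists q, 0; split; rewrite ?addr0 //; exact: submod0 (submodule_principal _).
have fm : fractional D (isum Q (principal D p)).
  apply: fractional_integral => //; have [x [Qx x0]] := max_nonzero mQ.
  by exists x; split=> //; exact: Qm.
have h1 : star (isum Q (principal D p)) 1.
  apply: (max_star_full mQ) nQp => //; exists 0, p.
  by split; rewrite ?add0r //; [exact: submod0|exact: principal_mem].
have [t [ht nzt {}h1]] := star_gen fm h1.
(* Each of the finitely many elements is split as $q + pd$, and the parts in [Q] are collected in
   [qs]. *)
have [qs [qsQ hqs]] : exists qs : seq K, (forall q, q \in qs -> Q q) /\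
    forall a, a \in t -> exists q d, [/\ q \in qs, D d & a = q + p * d].
  elim: t ht {nzt h1} => [|a t IH] ht; first by exists [::].
  have [qs [qsQ hqs]] := IH (fun b bt => ht b (mem_behead (s := a :: t) bt)).
  have [q [_ [Qq [d [Dd ->]] ->]]] := ht a (mem_head _ _).
  exists (q :: qs); split; first by move=> b; rewrite inE => /orP[/eqP ->|/qsQ].
  move=> b; rewrite inE => /orP[/eqP ->|/hqs[q' [d' [h' Dd' ->]]]].
    by exists q, d; rewrite mem_head.
  by exists q', d'; rewrite inE h' orbT.
have nzA : exists2 x, x \in p :: s & x != 0.
  by case: nz => x xs x0; exists x => //; rewrite inE xs orbT.
have nzB : exists2 x, x \in qs ++ s & x != 0.
  by case: nz => x xs x0; exists x => //; rewrite mem_cat xs orbT.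
have [] := @proper_finite_type_gen P (p :: s) => //.
  by move=> a; rewrite inE => /orP[/eqP ->|/Is/IP].
move=> pA fA; have [] := @proper_finite_type_gen Q (qs ++ s) => //.
  by move=> a; rewrite mem_cat => /orP[/qsQ|/Is/IQ].
move=> pB fB; apply: (hI _ _ pA fA pB fB).
- rewrite eI; apply: star_mono; [exact: fractional_gen|exact: fractional_gen|].
  by apply: gen_incl => a as_; rewrite inE as_ orbT.
- rewrite eI; apply: star_mono; [exact: fractional_gen|exact: fractional_gen|].
  by apply: gen_incl => a as_; rewrite mem_cat as_ orbT.
set A := star (gen D (p :: s)) in pA *; set B := star (gen D (qs ++ s)) in pB *.
have [[fracA _] iA _] := pA; have [[fracB _] iB _] := pB.
have [[sA _ _] [sB _ _]] := (fracA, fracB).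
have iAB : integral D (isum A B).
  by move=> _ [a [b [/iA Da /iB Db ->]]]; exact: subringD.
have fAB : fractional D (isum A B).
  apply: fractional_integral => //; first exact: submodule_isum.
  case: fracA => _ [x [Ax x0]] _; exists x; split=> //; exists x, 0.
  by split; rewrite ?addr0 //; exact: submod0.
apply/predeqP => y; split; first exact: (star_sub fAB star_ideal_ring iAB).
move=> Dy; rewrite -[y]mulr1; apply: submodZ => //; first exact: star_submodule.
apply: star_mono h1 => //; first exact: fractional_gen.
apply: gen_sub; first exact: submodule_isum.
move=> _ /hqs[q [d [qqs Dd ->]]]; exists (p * d), q; split; last by rewrite addrC.
- rewrite mulrC; apply: submodZ => //; apply: star_ext; first exact: fractional_gen.
  by apply: mem_gen; exact: mem_head.
- apply: star_ext; first exact: fractional_gen.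
  by apply: mem_gen; rewrite mem_cat qqs.
Qed.

(** * Elements lying in at most one maximal star-ideal *)

Definition homog_elt p :=
  [/\ D p, p != 0 & forall P Q, maxs P -> maxs Q -> P p -> Q p -> P = Q].

Definition loc_assoc P x y := localization D P (x / y) /\ localization D P (y / x).

Lemma loc_assocM P x y x' y' : maxs P -> loc_assoc P x y -> loc_assoc P x' y' ->
  loc_assoc P (x * x') (y * y').
Proof. by move=> mP [h1 h2] [h3 h4]; split; rewrite -mulf_div; exact: locM (max_prime mP) _ _ _ _. Qed.

Lemma loc_assocX P x y n : maxs P -> loc_assoc P x y -> loc_assoc P (x ^+ n) (y ^+ n).
Proof. by move=> mP [h1 h2]; split; rewrite -expr_div_n; exact: locX (max_prime mP) _ _ _. Qed.

Lemma homog_eltX p n : homog_elt p -> homog_elt (p ^+ n).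
Proof.
move=> [Dp p0 hp]; split; [exact: subringX|by rewrite expf_neq0|].
have PX P : maxs P -> P (p ^+ n) -> P p.
  by move=> mP h; apply: contrapT => np; exact: (prime_notX (n := n) (max_prime mP) Dp np).
by move=> P Q mP mQ /(PX _ mP) Pp /(PX _ mQ) Qp; exact: hp.
Qed.

(** Here $(I^n)^* = pD$. If [p] is in [P], then $z^n \in pD \subseteq P$ for all [z] in [I], so [P]
    contains [I] and is unique. At each [P] the witness [i] is a local generator of [I]: $i^n$ is a
    multiple of [p], while [p] lies in $(I^n)^* \subseteq i^n D_P$. *)
Lemma af_power I : star_af_homog D star I -> exists n p, [/\ (1 <= n)%N, homog_elt p &
  forall P, maxs P -> exists i, [/\ i != 0, I i, forall z, I z -> localization D P (z / i)
    & loc_assoc P (i ^+ n) p]].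
Proof.
move=> afI; have [hI af] := afI; have [_ fI _] := hI.
have fracI := af_fractional afI; have iI := af_integral afI.
have [n [n1 [p pn]]] := af I fI (fun x h => h).
have fIn := fractional_ipow n fracI.
have p0 : p != 0.
  have [_ [y [sy y0]] _] := star_fractional fIn; move: sy; rewrite pn => -[d [_ e]].
  by apply: contra_neq y0 => p0; rewrite e p0 mul0r.
have sp : star (ipow D I n) p by rewrite pn; exact: principal_mem.
have Ip z : I z -> D (z ^+ n / p).
  by move=> Iz; apply/(principalE _ p0); rewrite -pn; apply: star_ext => //; exact: mem_ipow.
exists n, p; split=> //.
  split=> //.
    apply: star_sub star_ideal_ring _ _ sp => //.
    elim: {n1 pn fIn Ip} n => [|n IH] y /=; first by [].
    move: y; apply: (@iprod_sub I (ipow D I n) D); first exact: submodule_ring.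
    by move=> a b /iI Da /IH; exact: subringM.
  have PI P : maxs P -> P p -> subset I P.
    move=> mP Pp z Iz; apply: contrapT => nz.
    apply: (prime_notX (n := n) (max_prime mP) (iI _ Iz) nz).
    by rewrite -[_ ^+ _](mulfVK p0); apply: submodZ (max_submodule mP) (Ip _ Iz) Pp.
  by move=> P Q mP mQ /(PI _ mP) IP /(PI _ mQ) IQ; exact: homog_max_unique hI mP mQ IP IQ.
move=> P mP; have [_ [_ [[s [nz ->]] eI]]] := fI.
have pn' : is_principal D (star (ipow D (star (gen D s)) n)) by rewrite -eI; exists p.
have [f [fs f0 hf]] := local_generator nz n1 pn' mP.
have If : I f by rewrite eI; apply: star_ext; [exact: fractional_gen|exact: mem_gen].
exists f; rewrite [in X in [/\ _, _, X & _]]eI; split=> //; split.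
  exact: loc_ring (max_prime mP) _ (Ip _ If).
apply: (star_loc mP fIn) sp; first exact: expf_neq0.
by apply: ipow_loc => //; rewrite eI.
Qed.

Lemma af_list_power (l : list (K -> Prop)) : List.Forall (star_af_homog D star) l ->
  exists n (ps : seq K), [/\ (1 <= n)%N, forall p, p \in ps -> homog_elt p &
  forall P, maxs P -> exists g, [/\ g != 0, iprod_list D l g,
    forall z, iprod_list D l z -> localization D P (z / g)
    & loc_assoc P (g ^+ n) (\prod_(p <- ps) p)]].
Proof.
elim: l => [|I l IH] => [_|/List.Forall_cons_iff[afI /IH[n [ps [n1 hps h]]]]].
  exists 1%N, [::]; split=> // P mP; exists 1; have pP := max_prime mP; split.
  - exact: oner_neq0.
  - exact: subring1.
  - by move=> z Dz; rewrite divr1; exact: loc_ring pP _ Dz.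
  - by rewrite big_nil expr1n; split; rewrite divr1; exact: loc_ring pP _ subring1.
have [m [p [m1 hp h']]] := af_power afI.
(* From $i^m \sim p$ and $g^n \sim \prod q$ in $D_P$, the common exponent $mn$ gives $(ig)^{mn} \sim
   p^n \prod q^m$. *)
exists (m * n)%N, (p ^+ n :: [seq q ^+ m | q <- ps]); split.
- by rewrite muln_gt0 m1 n1.
- move=> q; rewrite inE => /orP[/eqP ->|/mapP[r /hps hr ->]]; exact: homog_eltX.
move=> P mP; have pP := max_prime mP.
have [i [i0 Ii hi ip]] := h' P mP; have [g [g0 lg hg gp]] := h P mP.
exists (i * g); split.
- by rewrite mulf_neq0.
- exact: mem_iprod.
- apply: (@iprod_sub I (iprod_list D l) (fun z => localization D P (z / (i * g)))).
    exact: submodule_loc.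
  by move=> a b /hi ha /hg hb; rewrite -mulf_div; exact: locM.
- rewrite big_cons big_map prodrXl exprMn; apply: loc_assocM => //.
    by rewrite exprM; exact: loc_assocX.
  by rewrite mulnC exprM; exact: loc_assocX.
Qed.

(** * Least common multiples tested at the maximal star-ideals *)

Definition has_lcm a b := exists c, [/\ c != 0, D (c / a), D (c / b) &
  forall P, maxs P -> localization D P (a / c) \/ localization D P (b / c)].

(** The last clause of [has_lcm] makes [c] associated in each $D_P$ to [a] or to [b], so a common
    multiple of both is a multiple of [c] in every $D_P$, and hence in [D] by [ring_local]. *)
Lemma has_lcm_principal a b : a != 0 -> b != 0 -> has_lcm a b ->
  is_principal D (iinter (principal D a) (principal D b)).
Proof.
move=> a0 b0 [c [c0 ca cb h]]; exists c; apply/predeqP => z; split; last first.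
  move/(principalE _ c0) => hz; split; apply/principalE => //.
    have -> : z / a = z / c * (c / a) by field; rewrite c0 a0.
    exact: subringM.
  have -> : z / b = z / c * (c / b) by field; rewrite c0 b0.
  exact: subringM.
move=> [/(principalE _ a0) za /(principalE _ b0) zb]; apply/principalE => //.
apply: ring_local => P mP; have pP := max_prime mP.
have [hc|hc] := h P mP.
- exact: (loc_trans pP a0 hc (loc_ring pP za)).
- exact: (loc_trans pP b0 hc (loc_ring pP zb)).
Qed.

Lemma has_lcm_sym a b : has_lcm a b -> has_lcm b a.
Proof.
by move=> [c [c0 ca cb h]]; exists c; split=> // P /h[?|?]; [right|left].
Qed.

Lemma has_lcm_scale p a b : p != 0 -> has_lcm a b -> has_lcm (p * a) (p * b).
Proof.
move=> p0 [c [c0 ca cb h]]; exists (p * c).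
have e x y : (p * x) / (p * y) = x / y by rewrite -mulf_div divff // mul1r.
by rewrite !e; split; rewrite ?mulf_neq0 // => P /h; rewrite !e.
Qed.

Lemma has_lcm_assoc a b a' b' : a != 0 -> b != 0 -> D (a / a') -> D (a' / a) -> D (b / b') ->
  D (b' / b) -> has_lcm a b -> has_lcm a' b'.
Proof.
move=> a0 b0 aa' a'a bb' b'b [c [c0 ca cb h]]; exists c; split=> //.
- have -> : c / a' = (c / a) * (a / a') by rewrite mulrA mulfVK.
  exact: subringM.
- have -> : c / b' = (c / b) * (b / b') by rewrite mulrA mulfVK.
  exact: subringM.
move=> P mP; have pP := max_prime mP; have [hc|hc] := h P mP; [left|right].
- exact: (loc_trans pP a0 hc (loc_ring pP a'a)).
- exact: (loc_trans pP b0 hc (loc_ring pP b'b)).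
Qed.

Lemma prime_not_prod P (s : seq K) : prime_ideal D P -> (forall p, p \in s -> D p /\ ~ P p) ->
  D (\prod_(p <- s) p) /\ ~ P (\prod_(p <- s) p).
Proof.
move=> pP; elim: s => [|p s IH] h.
  by rewrite big_nil; split; [exact: subring1|exact: prime_not1].
have [Dp np] := h p (mem_head _ _).
have [Ds ns] := IH (fun q qs => h q (mem_behead (s := p :: s) qs)).
by rewrite big_cons; split; [exact: subringM|exact: prime_notM].
Qed.

Lemma prod_neq0 (s : seq K) : (forall p, p \in s -> homog_elt p) -> \prod_(p <- s) p != 0.
Proof. by move=> h; rewrite prodf_seq_neq0; apply/allP => p /h[]. Qed.

(* Induction on the number of factors: two factors p, q in a common maximal star-ideal P divide one
   another, since they are units at all other maximal star-ideals, and the smaller one is cancelled. *)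
Lemma has_lcm_homog (s t : seq K) :
  (forall P, maxs P -> valuation_domain (localization D P)) ->
  (forall p, p \in s -> homog_elt p) -> (forall p, p \in t -> homog_elt p) ->
  has_lcm (\prod_(p <- s) p) (\prod_(p <- t) p).
Proof.
move=> val; have [n] := ubnP (size s + size t); elim: n s t => // n IH s t sn hs ht.
have step s' t' p q P : (size s' + size t' < n.+1)%N ->
    (forall r, r \in s' -> homog_elt r) -> (forall r, r \in t' -> homog_elt r) ->
    p \in s' -> q \in t' -> maxs P -> P p -> localization D P (q / p) ->
    has_lcm (\prod_(r <- s') r) (\prod_(r <- t') r).
  move=> sn' hs' ht' ps qt mP Pp qp.
  have [Dp p0 hp] := hs' _ ps; have [Dq q0 hq] := ht' _ qt.
  have Dqp : D (q / p).
    apply: ring_local => Q mQ; have [QP|QP] := EM (Q p); first by rewrite (hp _ _ mQ mP).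
    by apply: (locM (max_prime mQ)); [exact: loc_ring (max_prime mQ) _ Dq|exact: loc_inv].
  (* Pulling out [p] deletes it from [s'] and replaces [q] by [q / p] in [t'], so the total number
     of factors drops by one. *)
  rewrite (big_rem p) //= (big_rem q (r := t')) //=.
  have -> : q * \prod_(r <- rem q t') r = p * \prod_(r <- (q / p) :: rem q t') r.
    by rewrite big_cons mulrA; congr (_ * _); field.
  apply: has_lcm_scale => //; apply: IH.
  - have : (0 < size t')%N by case: (t') qt.
    have : (0 < size s')%N by case: (s') ps.
    rewrite /= !size_rem //; move: sn'.
    by case: (size s') => // k; case: (size t') => // m; rewrite addSn ltnS.
  - by move=> r /mem_rem/hs'.
  (* The quotient [q / p] may be a unit, which [homog_elt] permits; any maximal star-ideal
     containing it also contains its multiple [q]. *)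
  - move=> r; rewrite inE => /orP[/eqP ->|/mem_rem/ht'] //; split=> //.
      by rewrite mulf_neq0 // invr_eq0.
    have PX Q : maxs Q -> Q (q / p) -> Q q.
      by move=> mQ /(submodZ (max_submodule mQ) Dp); rewrite mulrC mulfVK.
    by move=> Q Q' mQ mQ' /(PX _ mQ) h /(PX _ mQ') h'; exact: hq.
have [[p [q [P [ps qt mP Pp Pq]]]]|hno] :=
    EM (exists p q P, [/\ p \in s, q \in t, maxs P, P p & P q]).
  have [Dp p0 _] := hs _ ps; have [Dq q0 _] := ht _ qt.
  have qp0 : q / p != 0 by rewrite mulf_neq0 // invr_eq0.
  have [qp|] := val P mP _ qp0.
  - exact: (step _ _ _ _ _ _ _ _ ps qt mP Pp qp).
  - rewrite invf_div => pq; apply: has_lcm_sym.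
    by apply: (step _ _ _ _ _ _ _ _ qt ps mP Pq pq); rewrite // addnC.
set a := \prod_(r <- s) r; set b := \prod_(r <- t) r.
have a0 : a != 0 := prod_neq0 hs; have b0 : b != 0 := prod_neq0 ht.
have Dprod (u : seq K) : (forall p, p \in u -> homog_elt p) -> D (\prod_(r <- u) r).
  move=> h; elim: u h => [|p u IHu] h; first by rewrite big_nil; exact: subring1.
  rewrite big_cons; apply: subringM; first by case: (h p (mem_head _ _)).
  by apply: IHu => q qu; apply: h; rewrite inE qu orbT.
(* No maximal star-ideal now meets both lists, so at each [P] one of the two products is a unit of
   $D_P$ and the plain product serves as least common multiple. *)
exists (a * b); split.
- by rewrite mulf_neq0.
- by rewrite mulrAC divff // mul1r; exact: Dprod.
- by rewrite mulfK //; exact: Dprod.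
move=> P mP; have pP := max_prime mP.
have [[p [ps Pp]]|hs'] := EM (exists p, p \in s /\ P p).
- left; have -> : a / (a * b) = b^-1 by field; rewrite a0 b0.
  suff [Db nb] : D b /\ ~ P b by exact: loc_inv.
  apply: prime_not_prod => // q qt; split; first by case: (ht _ qt).
  by move=> Pq; apply: hno; exists p, q, P.
- right; have -> : b / (a * b) = a^-1 by field; rewrite a0 b0.
  suff [Da na] : D a /\ ~ P a by exact: loc_inv.
  apply: prime_not_prod => // p ps; split; first by case: (hs _ ps).
  by move=> Pp; apply: hs'; exists p.
Qed.

(** * From factorization to the almost GCD and IRKT properties *)

Section FactorizationToIRKT.
Context (hfact : forall x, D x -> x != 0 -> ~ unit_of D x -> exists l : list (K -> Prop),
  List.Forall (star_af_homog D star) l /\ principal D x = star_product D star l).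

(** Units are covered by the empty list, whose product is [D]. *)
Lemma af_factorization x : D x -> x != 0 -> exists l : list (K -> Prop),
  [/\ List.Forall (star_af_homog D star) l, fractional D (iprod_list D l) &
      principal D x = star (iprod_list D l)].
Proof.
move=> Dx x0; have [[_ Dxi]|nu] := EM (unit_of D x).
  exists [::]; split; [exact: List.Forall_nil|exact: fractional_ring|].
  rewrite /= star_ring; apply/predeqP => y; split=> [/(principalE _ x0) h|Dy].
    by rewrite -[y](mulfVK x0); exact: subringM.
  by apply/(principalE _ x0); exact: subringM.
have [l [hl e]] := hfact Dx x0 nu; exists l; split=> //.
apply: fractional_iprod_list; apply: List.Forall_impl hl; exact: af_fractional.
Qed.

Lemma factorization_local x l : x != 0 -> fractional D (iprod_list D l) ->
  principal D x = star (iprod_list D l) -> forall z, iprod_list D l z -> D (z / x).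
Proof. by move=> x0 fl e z lz; apply/(principalE _ x0); rewrite e; exact: star_ext. Qed.

Lemma factorization_valuation P : maxs P -> valuation_domain (localization D P).
Proof.
move=> mP k k0; have pP := max_prime mP.
have [a [b [Da Db b0 e]]] := hK k.
have a0 : a != 0 by apply: contra_neq k0 => a0; rewrite e a0 mul0r.
have [l [hl fl pl]] := af_factorization Da a0.
have [h|h] : localization D P (b / a) \/ localization D P (a / b).
  apply: (comparable_of_af_list hl) => //; first exact: loc_ring.
  by move=> z lz; apply: loc_ring => //; exact: factorization_local lz.
- by right; rewrite e invf_div.
- by left; rewrite e.
Qed.

Lemma factorization_locally_finite x : D x -> x != 0 ->
  exists l : list (K -> Prop), forall P, maxs P -> P x -> List.In P l.
Proof.
move=> Dx x0; have [l [hl fl pl]] := af_factorization Dx x0.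
have [L hL] : exists L : list (K -> Prop), forall P I, maxs P -> List.In I l ->
    subset I P -> List.In P L.
  elim: l hl {fl pl} => [|I l IH]; first by exists [::].
  move=> /List.Forall_cons_iff[[hI _] /IH[L hL]].
  have [[P [mP IP]]|hno] := EM (exists P, maxs P /\ subset I P).
    exists (P :: L) => Q J mQ [<-|Jl] JQ; last by right; exact: hL JQ.
    by left; exact: homog_max_unique hI mP mQ IP JQ.
  exists L => Q J mQ [<-|Jl] JQ; last exact: hL JQ.
  by case: hno; exists Q.
exists L => P mP Px.
have [I [Il IP]] : exists I, List.In I l /\ subset I P.
  apply: (prime_iprod_list (max_prime mP)); last first.
    by apply: List.Forall_impl hl; exact: af_integral.
  move=> z lz; have Dz := factorization_local x0 fl pl lz.
  by rewrite -[z](mulfVK x0); apply: submodZ Px => //; exact: max_submodule.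
exact: hL IP.
Qed.

(** A nonzero [x] in a common prime [Q] has an af-homog factor inside [Q], hence inside both [P1]
    and [P2], against [homog_max_unique]. *)
Lemma factorization_no_common_prime P1 P2 : maxs P1 -> maxs P2 -> P1 <> P2 ->
  ~ exists Q, [/\ prime_ideal D Q, nonzero_set Q, subset Q P1 & subset Q P2].
Proof.
move=> m1 m2 ne [Q [pQ [x [Qx x0]] Q1 Q2]].
have Dx : D x by case: pQ => _ iQ _ _; exact: iQ.
have [l [hl fl pl]] := af_factorization Dx x0.
have [I [Il IQ]] : exists I, List.In I l /\ subset I Q.
  apply: (prime_iprod_list pQ); last by apply: List.Forall_impl hl; exact: af_integral.
  move=> z lz; have Dz := factorization_local x0 fl pl lz.
  by rewrite -[z](mulfVK x0); apply: submodZ Qx => //; exact: prime_submodule.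
have [hI _] : star_af_homog D star I by apply: (proj1 (List.Forall_forall _ _) hl).
by apply: ne; apply: homog_max_unique hI m1 m2 _ _ => y /IQ; [exact: Q1|exact: Q2].
Qed.

(** At each [P] the local generator [g] of the product is associated to [x], because [star_loc]
    shows that star-closure does not leave $gD_P$. The relation between $g^n$ and the product of the
    [ps] thus holds for $x^n$ at every [P], and then in [D]. *)
Lemma factorization_power x : D x -> x != 0 -> exists n (ps : seq K),
  [/\ (1 <= n)%N, forall p, p \in ps -> homog_elt p, D (x ^+ n / \prod_(p <- ps) p)
    & D (\prod_(p <- ps) p / x ^+ n)].
Proof.
move=> Dx x0; have [l [hl fl pl]] := af_factorization Dx x0.
have [n [ps [n1 hps h]]] := af_list_power hl.
suff hP P : maxs P -> loc_assoc P (x ^+ n) (\prod_(p <- ps) p).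
  by exists n, ps; split=> //; apply: ring_local => P /hP[].
move=> mP; have pP := max_prime mP; have [g [g0 lg hg [h1 h2]]] := h P mP.
have xg : loc_assoc P x g.
  split; last by apply: loc_ring => //; exact: factorization_local lg.
  by apply: star_loc hg _ _ => //; rewrite -pl; exact: principal_mem.
have [h3 h4] := loc_assocX n mP xg.
have gn0 : g ^+ n != 0 by rewrite expf_neq0.
by split; [exact: loc_trans gn0 h1 h3|exact: loc_trans gn0 h4 h2].
Qed.

Lemma factorization_almost_GCD : almost_GCD D.
Proof.
move=> a b Da Db a0 b0.
have [n [ps [n1 hps a1 a2]]] := factorization_power Da a0.
have [m [qs [m1 hqs b1 b2]]] := factorization_power Db b0.
(* Raising the two relations to the powers [m] and [n] brings [a] and [b] to the same exponent;
   powers of the factors are again of type [homog_elt]. *)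
exists (n * m)%N; split; first by rewrite muln_gt0 n1 m1.
have hX (u : seq K) k : (forall p, p \in u -> homog_elt p) ->
    forall p, p \in [seq q ^+ k | q <- u] -> homog_elt p.
  by move=> hu p /mapP[q /hu hq ->]; exact: homog_eltX.
have := has_lcm_homog factorization_valuation (hX _ m hps) (hX _ n hqs).
rewrite !big_map !prodrXl => hl.
apply: has_lcm_principal; rewrite ?expf_neq0 //.
apply: has_lcm_assoc hl; rewrite ?expf_neq0 ?prod_neq0 //.
- by rewrite exprM -expr_div_n; exact: subringX.
- by rewrite exprM -expr_div_n; exact: subringX.
- by rewrite mulnC exprM -expr_div_n; exact: subringX.
- by rewrite mulnC exprM -expr_div_n; exact: subringX.
Qed.

Lemma factorization_IRKT : almost_GCD D /\ star_IRKT D star.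
Proof.
split; [exact: factorization_almost_GCD|split].
- exact: factorization_valuation.
- move=> y; split; last exact: ring_local.
  by move=> Dy P mP; apply: loc_ring => //; exact: max_prime.
- exact: factorization_locally_finite.
- exact: factorization_no_common_prime.
Qed.

End FactorizationToIRKT.

(** * Factorization in almost GCD IRKTs *)

Section IRKTToFactorization.
Context (hgcd : almost_GCD D) (hirkt : star_IRKT D star).

Lemma irkt_valuation P : maxs P -> valuation_domain (localization D P).
Proof. by case: hirkt => h _ _ _; exact: h. Qed.

Lemma irkt_comparable P a b : maxs P -> a != 0 -> b != 0 ->
  localization D P (a / b) \/ localization D P (b / a).
Proof.
move=> mP a0 b0; rewrite -[b / a]invf_div; apply: irkt_valuation => //.
by rewrite mulf_neq0 // invr_eq0.
Qed.

(** A common denominator [d] moves [a] and [b] into [D]; the generator obtained there is divided by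
    $d^n$. *)
Lemma almost_GCD_field a b : a != 0 -> b != 0 -> exists n c, [/\ (1 <= n)%N, c != 0,
  D (c / a ^+ n), D (c / b ^+ n) &
  forall z, D (z / a ^+ n) -> D (z / b ^+ n) -> D (z / c)].
Proof.
move=> a0 b0; have [d [Dd d0 Da Db]] := common_denominator a b.
have [da0 db0] : d * a != 0 /\ d * b != 0 by rewrite !mulf_neq0.
have [n [n1 [c hc]]] := hgcd Da Db da0 db0.
have [dan0 dbn0] : (d * a) ^+ n != 0 /\ (d * b) ^+ n != 0 by rewrite !expf_neq0.
have mem z : principal D c z <-> D (z / (d * a) ^+ n) /\ D (z / (d * b) ^+ n).
  rewrite -hc; split=> -[h1 h2]; split; first [exact/(principalE _ dan0)|exact/(principalE _ dbn0)].
have c0 : c != 0.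
  have /mem : D ((d * a) ^+ n * (d * b) ^+ n / (d * a) ^+ n) /\
       D ((d * a) ^+ n * (d * b) ^+ n / (d * b) ^+ n).
    by split; [rewrite mulrAC divff // mul1r|rewrite mulfK //]; exact: subringX.
  move=> [e [_ he]]; have : (d * a) ^+ n * (d * b) ^+ n != 0 by rewrite mulf_neq0.
  by apply: contra_neq => c0; rewrite he c0 mul0r.
have e z x : z / (d * x) ^+ n = z / d ^+ n / x ^+ n by rewrite exprMn invfM mulrA.
have [h1 h2] : D (c / (d * a) ^+ n) /\ D (c / (d * b) ^+ n) by apply/mem; exact: principal_mem.
have dn0 : d ^+ n != 0 by rewrite expf_neq0.
exists n, (c / d ^+ n); split=> //; rewrite -?e //; first by rewrite mulf_neq0 // invr_eq0.
move=> z za zb; rewrite invf_div mulrA; apply/(principalE _ c0); apply/mem.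
by rewrite !e mulfK.
Qed.

(** Induction on the list, with the greatest common divisor formed as product over least common
    multiple. In the valuation ring $D_P$ the least common multiple is associated to the larger of
    the two powers, so the quotient is associated to the smaller one, the power of an element [a]
    dividing the whole list. *)
Lemma local_gcd (s : seq K) : (exists2 x, x \in s & x != 0) -> exists n g,
  [/\ (1 <= n)%N, g != 0 & forall P, maxs P -> exists a, [/\ a \in s, a != 0,
    loc_assoc P (a ^+ n) g & forall b, b \in s -> localization D P (b / a)]].
Proof.
have zero P a : maxs P -> localization D P (0 / a).
  by move=> mP; rewrite mul0r; exact: loc_ring (max_prime mP) _ subring0.
have refl P a : maxs P -> a != 0 -> localization D P (a / a).
  by move=> mP a0; rewrite divff //; exact: loc_ring (max_prime mP) _ subring1.
elim: s => [|a s IH] nz; first by case: nz.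
have [/IH{IH}[n [g [n1 g0 h]]]|hno] := EM (exists2 x, x \in s & x != 0); last first.
  have s0 b : b \in s -> b = 0.
    by move=> bs; apply/eqP; apply: contrapT => /negP b0; apply: hno; exists b.
  have a0 : a != 0.
    by case: nz => x; rewrite inE => /orP[/eqP ->//|/s0 ->]; rewrite eqxx.
  exists 1%N, a; split=> // P mP; exists a; split=> //; first exact: mem_head.
    by split; rewrite expr1; exact: refl.
  by move=> b; rewrite inE => /orP[/eqP ->|/s0 ->]; [exact: refl|exact: zero].
have [a0|a0] := eqVneq a 0.
  exists n, g; split=> // P /[dup] mP /h[b [bs b0 bg hb]]; exists b; split=> //.
    by rewrite inE bs orbT.
  by move=> x; rewrite inE => /orP[/eqP ->|/hb //]; rewrite a0; exact: zero.
have an0 : a ^+ n != 0 by rewrite expf_neq0.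
have [m [c [m1 c0 ca cg hc]]] := almost_GCD_field an0 g0.
have u0 : (a ^+ n) ^+ m != 0 by rewrite expf_neq0.
have v0 : g ^+ m != 0 by rewrite expf_neq0.
(* If [v] divides [u] in $D_P$, some [t] outside [P] makes $tu$ a common multiple of [u] and [v]
   over [D], so [c] divides $tu$ there and [u] in $D_P$. *)
have lcm_loc P u v : maxs P -> u != 0 -> (forall z, D (z / u) -> D (z / v) -> D (z / c)) ->
    localization D P (u / v) -> localization D P (u / c).
  move=> mP {}u0 hz /(loc_clear (max_prime mP))[t [Dt nt Dtuv]].
  apply: (loc_of_clear (max_prime mP) Dt nt); rewrite mulrA; apply: hz; last by rewrite -mulrA.
  by rewrite mulfK.
exists (n * m)%N, ((a ^+ n) ^+ m * g ^+ m / c); split.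
- by rewrite muln_gt0 n1 m1.
- by rewrite !mulf_neq0 // invr_eq0.
move=> P mP; have pP := max_prime mP; have [b [bs b0 bg hb]] := h P mP.
have [bg1 bg2] := loc_assocX m mP bg.
have bnm0 : (b ^+ n) ^+ m != 0 by rewrite !expf_neq0.
have [ab|ba] := irkt_comparable mP a0 b0.
- exists b; split=> //; first by rewrite inE bs orbT.
    have uv : localization D P ((a ^+ n) ^+ m / g ^+ m).
      apply: (loc_trans pP bnm0 bg1).
      by rewrite -!expr_div_n; do 2!apply: (locX pP).
    have uc := lcm_loc P _ _ mP u0 hc uv.
    rewrite exprM; split.
    + apply: (loc_trans pP v0 _ bg1).
      have -> : g ^+ m / ((a ^+ n) ^+ m * g ^+ m / c) = c / (a ^+ n) ^+ m.
        by field; rewrite c0 u0 v0.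
      exact: loc_ring.
    + apply: (loc_trans pP v0 bg2).
      have -> : (a ^+ n) ^+ m * g ^+ m / c / g ^+ m = (a ^+ n) ^+ m / c.
        by field; rewrite c0 v0.
      by [].
  by move=> x; rewrite inE => /orP[/eqP ->|/hb].
- exists a; split=> //; first exact: mem_head.
    have vu : localization D P (g ^+ m / (a ^+ n) ^+ m).
      apply: (loc_trans pP bnm0 _ bg2).
      by rewrite -!expr_div_n; do 2!apply: (locX pP).
    have vc := lcm_loc P _ _ mP v0 (fun z h1 h2 => hc z h2 h1) vu.
    rewrite exprM; split.
    + have -> : (a ^+ n) ^+ m / ((a ^+ n) ^+ m * g ^+ m / c) = c / g ^+ m.
        by field; rewrite c0 u0 v0.
      exact: loc_ring.
    + have -> : (a ^+ n) ^+ m * g ^+ m / c / (a ^+ n) ^+ m = g ^+ m / c.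
        by field; rewrite c0 u0.
      by [].
  move=> x; rewrite inE => /orP[/eqP ->|/hb xb]; first exact: refl.
  exact: (loc_trans pP b0 ba xb).
Qed.

(** With [g] from [local_gcd], the generator [a] chosen at [P] satisfies $J \subseteq aD_P$ and $a^n
    \sim g$. So $J^n \subseteq gD_P$ for all [P], and conversely [g] is locally a multiple of $a^n
    \in J^n$; [star_local] concludes. *)
Lemma finite_type_power_principal J : finite_type D star J ->
  exists n, (1 <= n)%N /\ is_principal D (star (ipow D J n)).
Proof.
move=> [_ [_ [[s [nz ->]] ->]]]; have [n [g [n1 g0 h]]] := local_gcd nz.
have fg := fractional_gen nz; have fJ := star_fractional fg.
have fJn := fractional_ipow n fJ.
exists n; split=> //; exists g; apply/predeqP => y; split.
  apply: star_sub fJn (star_ideal_principal g0) _ y => z Jz.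
  apply/(principalE _ g0); apply: ring_local => P mP; have pP := max_prime mP.
  have [a [sa a0 [ag ga] hb]] := h P mP.
  have an0 : a ^+ n != 0 by rewrite expf_neq0.
  apply: (loc_trans pP an0 ag); apply: (ipow_loc mP) Jz.
  apply: star_loc => //.
  by apply: (@gen_sub s (fun z => localization D P (z / a))) => //; exact: submodule_loc.
move=> [d [Dd ->]]; rewrite mulrC; apply: submodZ => //; first exact: star_submodule.
apply: star_local => // P mP; have pP := max_prime mP.
have [a [sa a0 [ag ga] hb]] := h P mP.
have an0 : a ^+ n != 0 by rewrite expf_neq0.
have [t [Dt nt Dtg]] := loc_clear pP ga; exists t; split=> //.
have -> : t * g = (t * (g / a ^+ n)) * a ^+ n by field.
apply: submodZ => //; first exact: star_submodule.
apply: star_ext => //; apply: mem_ipow; apply: star_ext => //; exact: mem_gen.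
Qed.

(** * The components $xD_P \cap D$ of a principal ideal *)

Definition component x P : K -> Prop := fun d => D d /\ localization D P (d / x).

Section Component.
Context (x : K) (Dx : D x) (x0 : x != 0).

Lemma submodule_component P : maxs P -> is_submodule D (component x P).
Proof.
move=> mP; have hs := submodule_loc (max_prime mP) x.
split=> [|a b [Da ha] [Db hb]|d a Dd [Da ha]].
- by split; [exact: subring0|exact: submod0 hs].
- by split; [exact: subringD|exact: submodD hs ha hb].
- by split; [exact: subringM|exact: submodZ hs Dd ha].
Qed.

Lemma component_mem P : maxs P -> component x P x.
Proof.
by move=> mP; split=> //; rewrite divff //; exact: loc_ring (max_prime mP) _ subring1.
Qed.

Lemma fractional_component P : maxs P -> fractional D (component x P).
Proof.
move=> mP; apply: fractional_integral; first exact: submodule_component.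
  by exists x; split => //; exact: component_mem.
by move=> y [].
Qed.

(* Otherwise the radical of xD_P, a prime ideal because D_P is a valuation domain, meets D in a
   nonzero prime ideal contained in both P and Q. *)
Lemma component_separates P Q : maxs P -> maxs Q -> P <> Q ->
  exists t, component x P t /\ ~ Q t.
Proof.
move=> mP mQ PQ; have pP := max_prime mP; have pQ := max_prime mQ.
apply: contrapT => hno.
have compQ t : component x P t -> Q t by move=> ht; apply: contrapT => nQ; apply: hno; exists t.
have Px : P x.
  apply: contrapT => nPx; apply: (max_not1 mQ); apply: compQ.
  by split; [exact: subring1|rewrite mul1r; exact: loc_inv].
(* This is the radical of $xD_P$ intersected with [D]. The exponent 0 does no harm, since [x] in [P]
   keeps $1/x$ out of $D_P$. *)
pose R d := D d /\ exists n, localization D P (d ^+ n / x).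
have R0 : R 0.
  by split; [exact: subring0|exists 1%N; rewrite expr1 mul0r; exact: loc_ring pP _ subring0].
have Rloc d e n : D d -> R e -> e != 0 -> localization D P (d ^+ n / e) -> R d.
  move=> Dd [De [m hm]] e0 h; split=> //; exists (n * m)%N.
  rewrite exprM; apply: (loc_trans pP _ hm); first by rewrite expf_neq0.
  by rewrite -expr_div_n; exact: locX.
case: hirkt => _ _ _ /(_ P Q mP mQ PQ); apply; exists R; split.
- split.
  + split=> // [a b Ra Rb|d a Dd [Da [n hn]]]; last first.
      split; first exact: subringM.
      exists n; rewrite exprMn -mulrA; apply: (locM pP) => //.
      exact: loc_ring pP _ (subringX n Dd).
    have [Da Db] : D a /\ D b by case: Ra => ? _; case: Rb.
    have [->|a0] := eqVneq a 0; first by rewrite add0r.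
    have [->|b0] := eqVneq b 0; first by rewrite addr0.
    (* In $D_P$ the sum is a multiple of whichever of [a] and [b] divides the other. *)
    have [h|h] := irkt_comparable mP a0 b0.
    * apply: (@Rloc (a + b) b 1%N) => //; first exact: subringD.
      rewrite expr1 mulrDl divff //; apply: (locD pP) => //; exact: loc_ring pP _ subring1.
    * apply: (@Rloc (a + b) a 1%N) => //; first exact: subringD.
      rewrite expr1 mulrDl divff //; apply: (locD pP) => //; exact: loc_ring pP _ subring1.
  + by move=> y [].
  + move=> RD; have [_ [n]] : R 1 by rewrite RD; exact: subring1.
    by rewrite expr1n mul1r => /(loc_unit_notin pP Dx x0).
  + move=> a b Da Db Rab.
    have [->|a0] := eqVneq a 0; first by left.
    have [->|b0] := eqVneq b 0; first by right.
    have ab0 : a * b != 0 by rewrite mulf_neq0.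
    (* If [b] divides [a] in $D_P$, then $ab$ divides $a^2$, so [a] inherits membership in [R] from
       $ab$. *)
    have [h|h] := irkt_comparable mP a0 b0; [left|right].
    * apply: (@Rloc a _ 2%N Da Rab ab0).
      by have -> : a ^+ 2 / (a * b) = a / b by field; rewrite a0 b0.
    * apply: (@Rloc b _ 2%N Db Rab ab0).
      by have -> : b ^+ 2 / (a * b) = b / a by field; rewrite a0 b0.
- exists x; split=> //; split=> //; exists 1%N; rewrite expr1 divff //.
  exact: loc_ring pP _ subring1.
- move=> d [Dd [n hn]]; apply: contrapT => nd.
  have ndn := prime_notX (n := n) pP Dd nd.
  apply: (loc_unit_notin pP Dx x0) Px.
  have -> : x^-1 = (d ^+ n / x) * (d ^+ n)^-1.
    by rewrite mulrAC divff ?mul1r //; exact: prime_not_neq0 ndn.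
  by apply: (locM pP) => //; apply: loc_inv => //; exact: subringX.
- move=> d [Dd [n hn]]; apply: contrapT => nd.
  by apply: (prime_notX (n := n) pQ Dd nd); apply: compQ; split => //; exact: subringX.
Qed.

Lemma component_max_unique P Q : maxs P -> maxs Q -> subset (component x P) Q -> Q = P.
Proof.
move=> mP mQ h; apply: contrapT => QP.
by have [t [/h Qt nQ]] := component_separates mP mQ (fun e => QP (esym e)).
Qed.

(** The generators are [x] together with, for each of the finitely many other maximal star-ideals
    [Q] containing [x], an element of the component outside [Q]. Locally, [x] generates at [P] and
    is a unit where it is not contained; at each remaining [Q] the chosen element is a unit. *)
Lemma component_finite_type P : maxs P -> exists s : seq K,
  (exists2 y, y \in s & y != 0) /\ component x P = star (gen D s).
Proof.
move=> mP; have pP := max_prime mP.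
have [L hL] : exists l : list (K -> Prop), forall Q, maxs Q -> Q x -> List.In Q l.
  by case: hirkt => _ _ h _; exact: h.
have [ts [tsP hts]] : exists ts : seq K, (forall t, t \in ts -> component x P t) /\
    forall Q, maxs Q -> Q <> P -> List.In Q L -> exists t, t \in ts /\ ~ Q t.
  elim: L {hL} => [|Q L [ts [tsP hts]]]; first by exists [::].
  have [[mQ QP]|hno] := EM (maxs Q /\ Q <> P).
    have [t [ht nt]] := component_separates mP mQ (fun e => QP (esym e)).
    exists (t :: ts); split; first by move=> u; rewrite inE => /orP[/eqP ->|/tsP].
    move=> Q' mQ' Q'P [<-|/(hts _ mQ' Q'P)[u [us nu]]].
      by exists t; rewrite mem_head.
    by exists u; rewrite inE us orbT.
  exists ts; split=> // Q' mQ' Q'P [e|]; last exact: hts.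
  by case: hno; rewrite e.
have nz : exists2 y, y \in x :: ts & y != 0 by exists x; rewrite ?mem_head.
exists (x :: ts); split=> //; have fg := fractional_gen nz.
have genP : subset (gen D (x :: ts)) (component x P).
  apply: gen_sub; first exact: submodule_component.
  by move=> t; rewrite inE => /orP[/eqP ->|/tsP //]; exact: component_mem.
apply/predeqP => z; split; last first.
  move=> sz; split; first by apply: star_sub star_ideal_ring _ _ sz => // y /genP[].
  by apply: star_loc sz => // y /genP[].
move=> [Dz lz]; apply: star_local => // Q mQ.
have mem t : t \in x :: ts -> star (gen D (x :: ts)) t.
  by move=> ht; apply: star_ext => //; exact: mem_gen.
have sg := star_submodule fg.
have [QP|QP] := EM (Q = P).
  have [t [Dt nt Dtz]] := loc_clear pP lz; exists t; rewrite QP; split=> //.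
  have -> : t * z = (t * (z / x)) * x by field.
  by apply: submodZ => //; apply: mem; exact: mem_head.
have [Qx|nQx] := EM (Q x); last first.
  by exists x; split=> //; rewrite mulrC; apply: submodZ => //; apply: mem; exact: mem_head.
have [t [ht nt]] := hts _ mQ QP (hL _ mQ Qx); exists t; split=> //.
  by have [] := tsP _ ht.
by rewrite mulrC; apply: submodZ => //; apply: mem; rewrite inE ht orbT.
Qed.

(** [P] is the only maximal star-ideal above the component, so proper star-ideals [A] and [B]
    containing it lie in [P], and so does the closure of their sum. The power condition is
    [finite_type_power_principal]. *)
Lemma component_af P : maxs P -> P x -> star_af_homog D star (component x P).
Proof.
move=> mP Px; have pP := max_prime mP; have fc := fractional_component mP.
have [s [nz es]] := component_finite_type mP.
have fs := fractional_gen nz.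
split; last by move=> J fJ _; exact: finite_type_power_principal.
have sc : star_ideal D star (component x P) by rewrite es; exact: star_ideal_star.
split.
- split=> //; first by move=> y [].
  move=> cD; have [_] : component x P 1 by rewrite cD; exact: subring1.
  by rewrite mul1r => /(loc_unit_notin pP Dx x0).
- by split=> //; exists (gen D s); split=> //; exists s.
have sub A : proper_integral_star_ideal D star A -> subset (component x P) A -> subset A P.
  move=> /exists_maximal_star_ideal[Q [mQ AQ]] cA.
  by rewrite -(component_max_unique mP mQ) // => y /cA/AQ.
move=> A B pA _ pB _ /(sub _ pA) AP /(sub _ pB) BP e.
apply: (max_not1 mP); have sP := max_submodule mP.
have ABP : subset (isum A B) P by move=> _ [a [b [/AP Pa /BP Pb ->]]]; exact: submodD.
have fAB : fractional D (isum A B).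
  have [[[sA [a [Aa a0]] _] _] iA _] := pA; have [[[sB _ _] _] iB _] := pB.
  apply: fractional_integral; first exact: submodule_isum.
    by exists a; split=> //; exists a, 0; split; rewrite ?addr0 //; exact: submod0.
  by move=> y /ABP; exact: max_integral.
by apply: (star_sub fAB (max_star_ideal mP) ABP); rewrite e; exact: subring1.
Qed.

(** Locally the product contains [x] at the listed ideals and 1 elsewhere. The element is built by
    taking [x] from the component at [P] itself and a separating element outside [P] from every
    other component; absence of repetitions ensures that [x] enters only once. *)
Lemma iprod_list_components (l : list (K -> Prop)) : List.NoDup l ->
  (forall P, List.In P l -> maxs P) ->
  (forall P, List.In P l -> exists s,
     [/\ D s, ~ P s & iprod_list D (List.map (component x) l) (s * x)]) /\
  (forall P, maxs P -> ~ List.In P l -> exists s,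
     [/\ D s, ~ P s & iprod_list D (List.map (component x) l) s]).
Proof.
elim: l => [|Q l IH] nd hl.
  split=> // P mP _; exists 1; split; [exact: subring1|exact: max_not1|exact: subring1].
have /List.NoDup_cons_iff[Ql nd'] := nd.
have mQ : maxs Q by apply: hl; left.
have [h1 h2] := IH nd' (fun P Pl => hl P (or_intror Pl)).
split=> [P [<-|Pl]|P mP nPl].
- have [s [Ds ns hs]] := h2 _ mQ Ql; exists s; split=> //.
  by rewrite mulrC; apply: mem_iprod => //; exact: component_mem.
- have mP : maxs P by apply: hl; right.
  have QP : Q <> P by move=> e; apply: Ql; rewrite e.
  have [t [ht nt]] := component_separates mQ mP QP.
  have Dt : D t by case: ht.
  have [s [Ds ns hs]] := h1 _ Pl; exists (t * s); split; first exact: subringM.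
    exact: (prime_notM (max_prime mP)).
  by rewrite -mulrA; exact: mem_iprod.
have QP : Q <> P by move=> e; apply: nPl; left.
have [t [ht nt]] := component_separates mQ mP QP.
have Dt : D t by case: ht.
have [|s [Ds ns hs]] := h2 _ mP _; first by move=> Pl; apply: nPl; right.
exists (t * s); split; first exact: subringM.
  exact: (prime_notM (max_prime mP)).
exact: mem_iprod.
Qed.

Lemma iprod_list_sub (l : list (K -> Prop)) I : List.Forall (integral D) l ->
  List.In I l -> is_submodule D I -> subset (iprod_list D l) I.
Proof.
move=> hl Il sI; elim: l hl Il => [|J l IH] //= /List.Forall_cons_iff[iJ il] [e|Il].
  apply: (@iprod_sub J (iprod_list D l) I) => // a b Ja lb.
  by rewrite mulrC; apply: submodZ; [exact: sI|exact: integral_iprod_list lb|rewrite -e].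
apply: (@iprod_sub J (iprod_list D l) I) => // a b /iJ Da lb.
by apply: submodZ => //; exact: IH.
Qed.

Lemma component_factorization : exists l : list (K -> Prop),
  List.Forall (star_af_homog D star) l /\ principal D x = star_product D star l.
Proof.
have [L hL] : exists l : list (K -> Prop), forall Q, maxs Q -> Q x -> List.In Q l.
  by case: hirkt => _ _ h _; exact: h.
(* Local finiteness only bounds the maximal star-ideals containing [x] by a list; here that list is
   thinned to exactly those ideals, without repetition. *)
have [l [nd hl]] : exists l : list (K -> Prop), List.NoDup l /\
    forall P, List.In P l <-> [/\ List.In P L, maxs P & P x].
  elim: L {hL} => [|Q L [l [nd hl]]].
    by exists [::]; split; [exact: List.NoDup_nil|move=> P; split=> [//|[]]].
  have [[mQ Qx Ql]|hno] := EM [/\ maxs Q, Q x & ~ List.In Q l].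
    exists (Q :: l); split; first exact: List.NoDup_cons.
    move=> P; split=> [[<-|/hl[PL mP Px]]|[[->|PL] mP Px]].
    - by split=> //; left.
    - by split=> //; right.
    - by left.
    - by right; apply/hl.
  exists l; split=> // P; split=> [/hl[PL mP Px]|[[e|PL] mP Px]].
  - by split=> //; right.
  - by apply: contrapT => nl; apply: hno; rewrite e.
  - exact/hl.
have lmax P : List.In P l -> maxs P by move=> /hl[].
pose cl := List.map (component x) l.
have af : List.Forall (star_af_homog D star) cl.
  apply/List.Forall_forall => I /List.in_map_iff[P [<- /hl[_ mP Px]]].
  exact: component_af.
exists cl; split=> //.
have fcl : fractional D (iprod_list D cl).
  by apply: fractional_iprod_list; apply: List.Forall_impl af; exact: af_fractional.
have icl : List.Forall (integral D) cl by apply: List.Forall_impl af; exact: af_integral.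
have scl := star_submodule fcl.
apply/predeqP => y; split.
  move=> [d [Dd ->]]; rewrite mulrC; apply: submodZ => //.
  apply: star_local => // P mP.
  have [h1 h2] := iprod_list_components nd lmax.
  have [/h1[s [Ds ns hs]]|/(h2 _ mP)[s [Ds ns hs]]] := EM (List.In P l).
    by exists s; split=> //; exact: star_ext.
  by exists s; split=> //; rewrite mulrC; apply: submodZ => //; exact: star_ext.
apply: star_sub => // [|z hz]; first exact: star_ideal_principal.
(* For the reverse inclusion, at [P] containing [x] the product lies in the component of [P], hence
   in $xD_P$; at other [P] the element [x] is a unit. *)
apply/(principalE _ x0); apply: ring_local => P mP; have pP := max_prime mP.
have [Px|nPx] := EM (P x); last first.
  apply: (locM pP); last exact: loc_inv.
  exact: loc_ring pP _ (integral_iprod_list icl hz).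
suff [] : component x P z by [].
apply: iprod_list_sub hz => //; last exact: submodule_component.
by apply: List.in_map; apply/hl; split=> //; exact: hL.
Qed.

End Component.
End IRKTToFactorization.
End StarOperation.
End Homog.

Theorem theoremR2 (K : fieldType) (D : K -> Prop)
    (star : (K -> Prop) -> (K -> Prop))
    (hD : is_subring D) (hK : is_fraction_field D)
    (hstar : star_op D star) (hfc : finite_character D star) :
  (forall x, D x -> x != 0 -> ~ unit_of D x ->
     exists l : list (K -> Prop),
       Stdlib.Lists.List.Forall (star_af_homog D star) l /\
       principal D x = star_product D star l)
  <-> (almost_GCD D /\ star_IRKT D star).
Proof.
split=> [h|[hgcd hirkt] x Dx x0 _]; first exact: factorization_IRKT.
exact: component_factorization.
Qed.
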